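(* Consider the case without line thermal limits, as described in the context, and assume Assumptions 1 and 2 hold. Then for the DPPD dynamics (without line limits): 1) if $d(0)\in\Omega$, then $d_i(t)\in\Omega_i$ for all $i\in\mathcal N$ and all $t\ge0$; 2) every trajectory $(\eta,d,\hat\theta,P,\omega,\mu)$ is bounded; 3) every trajectory $(\eta,d,\hat\theta,P,\omega,\mu)$ converges globally and asymptotically to an equilibrium point $(\eta^*,d^*,\hat\theta^*,P^*,\omega^*,\mu^* )$ of the dynamics, where $(d^*,\hat\theta^*,P^*,\omega^* )$ is an optimal solution of the ROLC problem (without line limits).
   Context: Power network: a directed connected graph $\mathcal G(\mathcal N,\mathcal E)$ with buses $\mathcal N=\{1,\dots,n\}$ and lines $\mathcal E\subseteq\mathcal N\times\mathcal N$. Each line $ij$ has susceptance $B_{ij}>0$; each bus has damping $D_i>0$ and a given constant power injection $P_i^{in}\in\mathbb R$. For $x\in\mathbb R^n$ write $x_{ij}=x_i-x_j$. Costs: $f_i=f_{i,0}+f_{i,1}+f_{i,2}$, where $f_{i,0}:\mathbb R\to\mathbb R$ is differentiable, $f_{i,1}$ is the indicator function of $\Omega_i=[\underline d_i,\overline d_i]$ ($0$ on $\Omega_i$, $+\infty$ outside), and $f_{i,2}:\mathbb R\to\mathbb R$ is lower semicontinuous convex; $\Omega=\Omega_1\times\dots\times\Omega_n$. Assumption 1: each $f_{i,0}$ is $\beta$-strongly convex with $\beta>1$. Assumption 2 (Slater): there exist $\tilde d\in\mathrm{relint}(\Omega)$ and $\tilde\theta\in\mathbb R^n$ with $0=P_i^{in}-\tilde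 d_i+\sum_{k:ki\in\mathcal E}B_{ki}\tilde\theta_{ki}-\sum_{j:ij\in\mathcal E}B_{ij}\tilde\theta_{ij}$ for all $i$ and $\underline P_{ij}<B_{ij}\tilde\theta_{ij}<\overline P_{ij}$ for all $ij\in\mathcal E$ (for given line limits $\underline P_{ij}\le\overline P_{ij}$). ROLC problem without line limits: minimize over $d,\hat\theta,\omega\in\mathbb R^n$, $P=(P_{ij})_{ij\in\mathcal E}$ the function $\sum_i\big(f_i(d_i)+\tfrac{D_i}{2}\omega_i^2\big)$ subject to, for all $i\in\mathcal N$, $0=P_i^{in}-D_i\omega_i-d_i+\sum_{k:ki\in\mathcal E}P_{ki}-\sum_{j:ij\in\mathcal E}P_{ij}$ and $0=P_i^{in}-d_i+\sum_{k:ki\in\mathcal E}B_{ki}\hat\theta_{ki}-\sum_{j:ij\in\mathcal E}B_{ij}\hat\theta_{ij}$. Proximal operator: $\mathbf{prox}_{g}(y)=\arg\min_x\{g(x)+\tfrac12\|x-y\|^2\}$. DPPD dynamics without line limits (fixed constant $\kappa\in(0,1)$): with $u_{i,1}=P_i^{in}-d_i-D_i\omega_i+\sum_{k:ki\in\mathcal E}P_{ki}-\sum_{j:ij\in\mathcal E}P_{ij}$ and $u_{i,2}=P_i^{in}-d_i+\sum_{k:ki\in\mathcal E}B_{ki}\hat\theta_{ki}-\sum_{j:ij\in\mathcal E}B_{ij}\hat\theta_{ij}$: $\dot\eta_i=\mathbf{prox}_{f_{i,2}}(d_i-\kappa\eta_i)-d_i$; $\dot d_i=\mathbf{prox}_{f_{i,1}}\big(d_i-\nabla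 f_{i,0}(d_i)+\kappa\eta_i+\lambda_i+u_{i,1}+\mu_i+u_{i,2}\big)-d_i$; $\omega_i=\lambda_i$; $\dot{\hat\theta}_i=\sum_{j:ij\in\mathcal E}B_{ij}(\mu_i+u_{i,2}-\mu_j-u_{j,2})-\sum_{k:ki\in\mathcal E}B_{ki}(\mu_k+u_{k,2}-\mu_i-u_{i,2})$; $\dot P_{ij}=\lambda_i+u_{i,1}-\lambda_j-u_{j,1}$; $\dot\lambda_i=\tfrac12u_{i,1}$; $\dot\mu_i=\tfrac12u_{i,2}$. An equilibrium point is a point at which all these right-hand sides vanish. *)

(* Defs.v *)
From HB Require Import structures.
From mathcomp Require Import all_boot all_order all_algebra.
From mathcomp Require Import all_classical all_reals all_analysis.
Set Implicit Arguments. Unset Strict Implicit. Unset Printing Implicit Defensive.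
Import Order.TTheory GRing.Theory Num.Theory.
Import numFieldNormedType.Exports.
Local Open Scope classical_set_scope.
Local Open Scope ring_scope.

Definition convex_on_R {R : realType} (f : R -> R) :=
  forall x y t : R, 0 <= t <= 1 ->
    f (t * x + (1 - t) * y) <= t * f x + (1 - t) * f y.

Definition strongly_convex {R : realType} (beta : R) (f : R -> R) :=
  forall x y t : R, 0 <= t <= 1 ->
    f (t * x + (1 - t) * y) <=
      t * f x + (1 - t) * f y - beta / 2 * t * (1 - t) * (x - y) ^+ 2.

Definition indicator_itv {R : realType} (lo hi : R) (x : R) : \bar R :=
  if (lo <= x) && (x <= hi) then 0%E else +oo%E.

(* prox_g(y) = argmin_x { g x + 1/2 |x - y|^2 } for an extended-valued g;
   the minimizer is required to lie in the effective domain of g.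
   (xget picks the minimizer; it is unique in all uses below.) *)
Definition prox {R : realType} (g : R -> \bar R) (y : R) : R :=
  xget 0 [set x | (g x < +oo)%E /\
     forall z, (g x + ((x - y) ^+ 2 / 2)%:E <= g z + ((z - y) ^+ 2 / 2)%:E)%E].

Definition weakly_connected {n : nat} (E : rel 'I_n) :=
  forall i j : 'I_n, connect (fun a b => E a b || E b a) i j.

Definition u1 {R : realType} {n : nat} (E : rel 'I_n) (Pin D : 'I_n -> R)
  (d w : 'I_n -> R) (P : 'I_n -> 'I_n -> R) (i : 'I_n) : R :=
  Pin i - d i - D i * w i + (\sum_(k < n | E k i) P k i)
    - (\sum_(j < n | E i j) P i j).

Definition u2 {R : realType} {n : nat} (E : rel 'I_n) (B : 'I_n -> 'I_n -> R)
  (Pin : 'I_n -> R) (d th : 'I_n -> R) (i : 'I_n) : R :=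
  Pin i - d i + (\sum_(k < n | E k i) B k i * (th k - th i))
    - (\sum_(j < n | E i j) B i j * (th i - th j)).

(* total cost (extended-valued, f_{i,1} is the indicator of Omega_i) *)
Definition rolc_cost {R : realType} {n : nat} (f0 f2 : 'I_n -> R -> R)
  (lo hi D : 'I_n -> R) (d w : 'I_n -> R) : \bar R :=
  (\sum_(i < n) ((f0 i (d i))%:E + indicator_itv (lo i) (hi i) (d i)
                 + (f2 i (d i))%:E + (D i / 2 * w i ^+ 2)%:E))%E.

Definition rolc_feasible {R : realType} {n : nat} (E : rel 'I_n)
  (B : 'I_n -> 'I_n -> R) (Pin D : 'I_n -> R)
  (d th w : 'I_n -> R) (P : 'I_n -> 'I_n -> R) :=
  forall i, u1 E Pin D d w P i = 0 /\ u2 E B Pin d th i = 0.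

Definition rolc_optimal {R : realType} {n : nat} (E : rel 'I_n)
  (B : 'I_n -> 'I_n -> R) (Pin D lo hi : 'I_n -> R) (f0 f2 : 'I_n -> R -> R)
  (d th w : 'I_n -> R) (P : 'I_n -> 'I_n -> R) :=
  rolc_feasible E B Pin D d th w P /\
  (rolc_cost f0 f2 lo hi D d w < +oo)%E /\
  forall d' th' w' P', rolc_feasible E B Pin D d' th' w' P' ->
    (rolc_cost f0 f2 lo hi D d w <= rolc_cost f0 f2 lo hi D d' w')%E.

(* right-hand sides, evaluated at a state (eta, d, th, P, lam, mu), omega = lam *)
Definition rhs_eta {R : realType} {n : nat} (f2 : 'I_n -> R -> R) (kappa : R)
  (eta d : 'I_n -> R) (i : 'I_n) : R :=
  prox (fun x => (f2 i x)%:E) (d i - kappa * eta i) - d i.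

Definition rhs_d {R : realType} {n : nat} (E : rel 'I_n) (B : 'I_n -> 'I_n -> R)
  (Pin D lo hi : 'I_n -> R) (f0 : 'I_n -> R -> R) (kappa : R)
  (eta d th : 'I_n -> R) (P : 'I_n -> 'I_n -> R) (lam mu : 'I_n -> R)
  (i : 'I_n) : R :=
  prox (indicator_itv (lo i) (hi i))
    (d i - derive1 (f0 i) (d i) + kappa * eta i + lam i + u1 E Pin D d lam P i
       + mu i + u2 E B Pin d th i) - d i.

Definition rhs_th {R : realType} {n : nat} (E : rel 'I_n) (B : 'I_n -> 'I_n -> R)
  (Pin : 'I_n -> R) (d th mu : 'I_n -> R) (i : 'I_n) : R :=
  (\sum_(j < n | E i j) B i j * (mu i + u2 E B Pin d th i - mu j - u2 E B Pin d th j))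
  - (\sum_(k < n | E k i) B k i * (mu k + u2 E B Pin d th k - mu i - u2 E B Pin d th i)).

Definition rhs_P {R : realType} {n : nat} (E : rel 'I_n) (Pin D : 'I_n -> R)
  (d : 'I_n -> R) (P : 'I_n -> 'I_n -> R) (lam : 'I_n -> R) (i j : 'I_n) : R :=
  lam i + u1 E Pin D d lam P i - lam j - u1 E Pin D d lam P j.

Definition rhs_lam {R : realType} {n : nat} (E : rel 'I_n) (Pin D : 'I_n -> R)
  (d : 'I_n -> R) (P : 'I_n -> 'I_n -> R) (lam : 'I_n -> R) (i : 'I_n) : R :=
  u1 E Pin D d lam P i / 2.

Definition rhs_mu {R : realType} {n : nat} (E : rel 'I_n) (B : 'I_n -> 'I_n -> R)
  (Pin : 'I_n -> R) (d th : 'I_n -> R) (i : 'I_n) : R :=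
  u2 E B Pin d th i / 2.

(* equilibrium point: all right-hand sides vanish (omega^* = lambda^* ) *)
Definition dppd_equilibrium {R : realType} {n : nat} (E : rel 'I_n)
  (B : 'I_n -> 'I_n -> R) (Pin D lo hi : 'I_n -> R) (f0 f2 : 'I_n -> R -> R)
  (kappa : R) (eta d th : 'I_n -> R) (P : 'I_n -> 'I_n -> R)
  (lam mu : 'I_n -> R) :=
  (forall i, rhs_eta f2 kappa eta d i = 0) /\
  (forall i, rhs_d E B Pin D lo hi f0 kappa eta d th P lam mu i = 0) /\
  (forall i, rhs_th E B Pin d th mu i = 0) /\
  (forall i j, E i j -> rhs_P E Pin D d P lam i j = 0) /\
  (forall i, rhs_lam E Pin D d P lam i = 0) /\
  (forall i, rhs_mu E B Pin d th i = 0).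

Definition dppd_trajectory {R : realType} {n : nat} (E : rel 'I_n)
  (B : 'I_n -> 'I_n -> R) (Pin D lo hi : 'I_n -> R) (f0 f2 : 'I_n -> R -> R)
  (kappa : R) (eta d th : 'I_n -> R -> R) (P : 'I_n -> 'I_n -> R -> R)
  (w lam mu : 'I_n -> R -> R) :=
  let at_ (x : 'I_n -> R -> R) t := fun i => x i t in
  let atP t := fun i j => P i j t in
  (forall i t, w i t = lam i t) /\
  (forall i, {within `[0, +oo[%classic, continuous (eta i)}) /\
  (forall i, {within `[0, +oo[%classic, continuous (d i)}) /\
  (forall i, {within `[0, +oo[%classic, continuous (th i)}) /\
  (forall i j, E i j -> {within `[0, +oo[%classic, continuous (P i j)}) /\
  (forall i, {within `[0, +oo[%classic, continuous (lam i)}) /\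
  (forall i, {within `[0, +oo[%classic, continuous (mu i)}) /\
  forall t : R, 0 < t ->
    (forall i, is_derive t 1 (eta i) (rhs_eta f2 kappa (at_ eta t) (at_ d t) i)) /\
    (forall i, is_derive t 1 (d i)
        (rhs_d E B Pin D lo hi f0 kappa (at_ eta t) (at_ d t) (at_ th t)
           (atP t) (at_ lam t) (at_ mu t) i)) /\
    (forall i, is_derive t 1 (th i)
        (rhs_th E B Pin (at_ d t) (at_ th t) (at_ mu t) i)) /\
    (forall i j, E i j -> is_derive t 1 (P i j)
        (rhs_P E Pin D (at_ d t) (atP t) (at_ lam t) i j)) /\
    (forall i, is_derive t 1 (lam i)
        (rhs_lam E Pin D (at_ d t) (atP t) (at_ lam t) i)) /\
    (forall i, is_derive t 1 (mu i)
        (rhs_mu E B Pin (at_ d t) (at_ th t) i)).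

Definition bounded_fwd {R : realType} (x : R -> R) :=
  exists M : R, forall t, 0 <= t -> `|x t| <= M.

(* relative interior of the interval [lo, hi] (empty if lo > hi, {lo} if lo = hi) *)
Definition in_relint_itv {R : realType} (lo hi x : R) :=
  (lo < x < hi) \/ (lo = x /\ x = hi).

(* Main.v *)
Require Import Defs.
From HB Require Import structures.
From mathcomp Require Import all_boot all_order all_algebra.
From mathcomp Require Import all_classical all_reals all_analysis.
From mathcomp Require Import ring lra.
Import Order.TTheory GRing.Theory Num.Theory.
Import numFieldNormedType.Exports.
Local Open Scope classical_set_scope.
Local Open Scope ring_scope.

(** Write [x~] for the deviation of [x] from an equilibrium [xs], where [lam]
    vanishes. The sum over buses of
      [d~^2/2 + Breg_f0 (d, ds) + kappa/2 eta~^2 - kappa eta~ d~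
       + (mu~ + u2)^2/2 + mu~^2/2 + th~^2/2 + (lam + u1)^2/2 + lam^2/2 + 3/2 D lam^2],
    plus the sum over lines of [P~^2/2], is a Lyapunov function [V]: it
    is coercive and, by the variational inequalities characterizing the two
    proximal maps, its derivative along trajectories is at most
    [- c |vector field|^2] for some [c > 0]; the cross term [- kappa eta~ d~] is
    what couples the two proximal steps. So trajectories are bounded, and there are arbitrarily
    late times at which the vector field is arbitrarily small. Along an
    ultrafilter of such times the trajectory converges, by continuity to an
    equilibrium; [V] centred at that equilibrium is nonincreasing and tends to 0
    along the ultrafilter, hence tends to 0, which gives convergence.

    An equilibrium exists: the minimizers [d i] of [f0 i + f2 i - m x] on
    [[lo i, hi i]] depend continuously on the common price [m], the intermediate
    value theorem balances the total load, and the Laplacian of a connected graph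
    maps onto the vectors of zero sum. *)

(** * Convex functions of one real variable *)

Lemma derive1_approx {R : realType} (f : R -> R) (x e : R) :
  derivable f x 1 -> 0 < e ->
  exists2 r : R, 0 < r & forall h, `|h| < r ->
    `|f (x + h) - f x - derive1 f x * h| <= e * `|h|.
Proof.
move=> df e0.
have /cvgrPdist_lt /(_ e e0) : h^-1 *: (f (h *: 1 + x) - f x) @[h --> 0^'] --> derive1 f x.
  by rewrite derive1E; exact: df.
move=> /nbhs_ballP[r /= r0 H]; exists r => // h hr.
have [->|h0] := eqVneq h 0; first by rewrite addr0 mulr0 !subrr normr0 mulr0.
have := H h; rewrite /ball /= sub0r normrN => /(_ hr h0) /ltW.
rewrite /GRing.scale /= mulr1 (addrC h) => K.
rewrite -normrN.
have -> : - (f (x + h) - f x - derive1 f x * h) = (derive1 f x - h^-1 * (f (x + h) - f x)) * h.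
  by field.
by rewrite normrM ler_pM2r // normr_gt0.
Qed.

(** The term [t ^+ 2 * b] is of second order, so dividing by [t] and letting [t] tend to 0 leaves
    the slopes. It absorbs the quadratic part of strong convexity below. *)
Lemma derive1_direction_ge {R : realType} (f : R -> R) (x v a b t0 : R) :
  derivable f x 1 -> 0 < t0 ->
  (forall t, 0 < t <= t0 -> t * a - t ^+ 2 * b <= f (x + t * v) - f x) ->
  a <= derive1 f x * v.
Proof.
move=> df t0_gt0 H; apply/ler_addgt0Pr => e e0.
pose e1 := e / 2 / (1 + `|v|).
have v1 : 0 < 1 + `|v| by rewrite ltr_pwDl.
have e1_gt0 : 0 < e1 by rewrite !divr_gt0.
have [r r0 K] := derive1_approx f x e1 df e1_gt0.
have b1 : 0 < 1 + `|b| by rewrite ltr_pwDl.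
(* The three bounds keep [t] admissible, keep [t * v] within the radius [r], and make [t * b] at
   most [e / 2]. The summand [1] in the denominators avoids a division by zero. *)
pose t := Num.min t0 (Num.min (r / 2 / (1 + `|v|)) (e / 2 / (1 + `|b|))).
have tgt0 : 0 < t by rewrite !lt_min t0_gt0 !divr_gt0.
have tle0 : t <= t0 by rewrite ge_min lexx.
have tr : t * (1 + `|v|) <= r / 2 by rewrite -ler_pdivlMr // !ge_min lexx !orbT.
have tb : t * (1 + `|b|) <= e / 2 by rewrite -ler_pdivlMr // !ge_min lexx !orbT.
have {}H := H t; rewrite tgt0 tle0 in H; have {}H := H isT.
have tv : `|t * v| < r.
  rewrite normrM gtr0_norm //; have := normr_ge0 v; nra.
have {}K := K _ tv.
have : f (x + t * v) - f x - derive1 f x * (t * v) <= e1 * (t * `|v|).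
  by apply: le_trans (ler_norm _) _; apply: le_trans K _; rewrite normrM (gtr0_norm tgt0).
have : e1 * `|v| <= e / 2.
  have : e1 * (1 + `|v|) = e / 2 by rewrite /e1 divfK // gt_eqF.
  nra.
have hb := ler_norm b.
move=> h1 h2.
have : t * a <= t * (derive1 f x * v + e) by nra.
by rewrite ler_pM2l.
Qed.

Lemma derive1_direction_le {R : realType} (f : R -> R) (x v a b t0 : R) :
  derivable f x 1 -> 0 < t0 ->
  (forall t, 0 < t <= t0 -> f (x + t * v) - f x <= t * a + t ^+ 2 * b) ->
  derive1 f x * v <= a.
Proof.
move=> df t0_gt0 H.
have := @derive1_direction_ge R (- f) x v (- a) b t0 (derivableN df) t0_gt0.
rewrite derive1E deriveN // -derive1E mulNr lerN2; apply => t /H.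
by rewrite !fctE; lra.
Qed.

(** In the defining inequality [t * (1 - t)] is [t] up to a [t ^+ 2] correction, so the full modulus
    [beta / 2] survives the limit of the difference quotients. *)
Lemma strongly_convex_tangent {R : realType} (beta : R) (f : R -> R) (x y : R) :
  0 <= beta -> strongly_convex beta f -> derivable f x 1 ->
  f x + derive1 f x * (y - x) + beta / 2 * (y - x) ^+ 2 <= f y.
Proof.
move=> b0 sc df.
suff : derive1 f x * (y - x) <= f y - f x - beta / 2 * (y - x) ^+ 2 by lra.
apply: (@derive1_direction_le R f x (y - x) _ (beta / 2 * (y - x) ^+ 2) 1) => // t /andP[t0 t1].
have := sc y x t; rewrite (ltW t0) t1 => /(_ isT).
have -> : t * y + (1 - t) * x = x + t * (y - x) by ring.
by move=> h; nra.
Qed.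

Lemma strongly_convex_monotone {R : realType} (beta : R) (f : R -> R) (x y : R) :
  0 <= beta -> strongly_convex beta f -> derivable f x 1 -> derivable f y 1 ->
  beta * (x - y) ^+ 2 <= (derive1 f x - derive1 f y) * (x - y).
Proof.
move=> b0 sc dx dy.
have := strongly_convex_tangent _ _ _ y b0 sc dx.
have := strongly_convex_tangent _ _ _ x b0 sc dy.
by nra.
Qed.

(** For a fixed step [h], the tangents at [y] squeeze [derive1 f y] between the backward and forward
    quotients of step [h]. These are continuous in [y] and, at [y = x], close to [derive1 f x]. *)
Lemma tangent_derive1_continuous {R : realType} (f : R -> R) :
  (forall x, derivable f x 1) ->
  (forall x y, f x + derive1 f x * (y - x) <= f y) ->
  continuous (derive1 f).
Proof.
move=> df tg x; apply/cvgrPdist_le => e e0.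
have e4 : 0 < e / 4 by rewrite divr_gt0.
have [r r0 K] := derive1_approx f x _ (df x) e4.
have fc z : {for z, continuous f} by apply/differentiable_continuous/derivable1_diffP.
pose h := r / 2.
have h0 : 0 < h by rewrite divr_gt0.
have hr : `|h| < r by rewrite gtr0_norm // /h; lra.
have hr' : `|- h| < r by rewrite normrN.
have {hr}Kp := K _ hr; have {hr'}Km := K _ hr'.
rewrite normrN !(gtr0_norm h0) in Kp Km.
have eh : 0 < e / 4 * h by rewrite mulr_gt0.
have shift c : f (y + c) @[y --> x] --> f (x + c).
  by apply: (@continuous_comp _ _ _ (fun y => y + c) f x); [exact: cvgD cvg_id (cvg_cst _)|exact: fc].
have /cvgrPdist_le/(_ _ eh) Np := shift h.
have /cvgrPdist_le/(_ _ eh) Nm := shift (- h).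
have /cvgrPdist_le/(_ _ eh) N0 := fc x.
near=> y.
have Np1 : `|f (x + h) - f (y + h)| <= e / 4 * h by near: y.
have Nm1 : `|f (x - h) - f (y - h)| <= e / 4 * h by near: y.
have N01 : `|f x - f y| <= e / 4 * h by near: y.
have T1 := tg y (y + h); have T2 := tg y (y - h).
rewrite !ler_norml in Kp Km Np1 Nm1 N01 *.
have : h * (derive1 f x - derive1 f y) <= h * e by lra.
have : h * (- e) <= h * (derive1 f x - derive1 f y) by lra.
by rewrite !ler_pM2l // => -> ->.
Unshelve. all: by end_near. Qed.

Definition subgradient {R : realType} (g : R -> R) (x s : R) :=
  forall z, g x + s * (z - x) <= g z.

(* The supremum of the left slopes, with [c] thrown in when it lies below all
   right slopes: the resulting subgradient is the one closest to [c]. *)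
Lemma convex_subgradient_near {R : realType} (g : R -> R) (x c : R) :
  convex_on_R g ->
  exists s, [/\ subgradient g x s,
    (forall z, x < z -> c * (z - x) <= g z - g x) -> c <= s &
    (forall z, z < x -> c * (z - x) <= g z - g x) -> s <= c].
Proof.
move=> cg.
have slopes y z : y < x -> x < z ->
    (g x - g y) / (x - y) <= (g z - g x) / (z - x).
  move=> yx xz.
  have xy0 : 0 < x - y by rewrite subr_gt0.
  have zx0 : 0 < z - x by rewrite subr_gt0.
  rewrite ler_pdivrMr // mulrAC ler_pdivlMr //.
  have zy0 : 0 < z - y by lra.
  have := cg z y ((x - y) / (z - y)).
  rewrite divr_ge0 ?(ltW xy0) ?(ltW zy0) //= ler_pdivrMr // mul1r.
  rewrite lerD2r (ltW xz) => /(_ isT).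
  have -> : (x - y) / (z - y) * z + (1 - (x - y) / (z - y)) * y = x.
    by field; rewrite gt_eqF.
  have -> : 1 - (x - y) / (z - y) = (z - x) / (z - y) by field; rewrite gt_eqF.
  rewrite mulrAC (mulrAC _ _ (g y)) -mulrDl ler_pdivlMr //.
  by lra.
pose S : set R := [set r | (exists2 y, y < x & r = (g x - g y) / (x - y)) \/
  (r = c /\ forall z, x < z -> c * (z - x) <= g z - g x)].
have S0 : S !=set0.
  by exists ((g x - g (x - 1)) / (x - (x - 1))); left; exists (x - 1) => //; lra.
have ubS z : x < z -> ubound S ((g z - g x) / (z - x)).
  move=> xz r [[y yx ->]|[-> H]]; first exact: slopes.
  by rewrite ler_pdivlMr ?subr_gt0 // H.
have hS : has_sup S.
  by split => //; exists ((g (x + 1) - g x) / (x + 1 - x)); apply: ubS; lra.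
exists (sup S); split.
- move=> z; have [zx|xz|<-] := ltgtP z x; last by rewrite subrr mulr0 addr0.
  + have : (g x - g z) / (x - z) <= sup S.
      by apply: ub_le_sup; [exact: hS.2|left; exists z].
    by rewrite ler_pdivrMr ?subr_gt0 //; lra.
  + have : sup S <= (g z - g x) / (z - x) by apply: ge_sup => //; exact: ubS.
    by rewrite ler_pdivlMr ?subr_gt0 //; lra.
- by move=> H; apply: ub_le_sup; [exact: hS.2|right].
- move=> H; apply: ge_sup => // r [[y yx ->]|[-> _]] //.
  by rewrite ler_pdivrMr ?subr_gt0 //; have := H y yx; lra.
Qed.

(** Near [x], a subgradient bounds [g] from below and the chord to [x + 1] or [x - 1] bounds it from
    above, both with slope at most [K]. *)
Lemma convex_continuous {R : realType} (g : R -> R) : convex_on_R g -> continuous g.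
Proof.
move=> cg x.
have [s [sg _ _]] := convex_subgradient_near g x 0 cg.
pose K := `|s| + `|g (x + 1) - g x| + `|g (x - 1) - g x|.
have K0 : 0 <= K by rewrite !addr_ge0.
have bd y : `|y - x| <= 1 -> `|g x - g y| <= K * `|y - x|.
  move=> yx1; rewrite ler_norml.
  have lo : g x - g y <= K * `|y - x|.
    have : - (s * (y - x)) <= `|s| * `|y - x| by rewrite -normrM -normrN ler_norm.
    have := normr_ge0 (g (x + 1) - g x); have := normr_ge0 (g (x - 1) - g x).
    by have := sg y; have := normr_ge0 (y - x); rewrite /K; nra.
  suff up : g y - g x <= K * `|y - x| by rewrite lo andbT; lra.
  have n1 := ler_norm (g (x + 1) - g x); have n2 := ler_norm (g (x - 1) - g x).
  have ns := normr_ge0 s.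
  have m1 := normr_ge0 (g (x + 1) - g x); have m2 := normr_ge0 (g (x - 1) - g x).
  have [xy|yx] := leP 0 (y - x).
    rewrite ger0_norm // in yx1 *.
    have := cg (x + 1) x (y - x); rewrite xy yx1 => /(_ isT).
    have -> : (y - x) * (x + 1) + (1 - (y - x)) * x = y by ring.
    by rewrite /K; nra.
  rewrite ltr0_norm // in yx1 *.
  have := cg (x - 1) x (- (y - x)); rewrite yx1 oppr_ge0 (ltW yx) => /(_ isT).
  have -> : - (y - x) * (x - 1) + (1 - (- (y - x))) * x = y by ring.
  by rewrite /K; nra.
apply/cvgrPdist_le => e e0.
have d0 : 0 < Num.min 1 (e / (1 + K)) by rewrite lt_min ltr01 divr_gt0 // ltr_pwDl.
near=> y.
have : `|x - y| <= Num.min 1 (e / (1 + K)) by near: y; apply: (@cvgr_dist_le _ _ _ (nbhs x) _ id x) => //; exact: cvg_id.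
rewrite le_min distrC => /andP[y1]; rewrite ler_pdivlMr; last by rewrite ltr_pwDl.
move=> ye; apply: le_trans (bd y y1) _; have := normr_ge0 (y - x); nra.
Unshelve. all: by end_near. Qed.

(** Convexity bounds the increment of [g] on the segment by [t * (g z - g x)], so only [f] has to be
    differentiated. The cutoff [t0] serves constrained minima: [z] itself may be outside the
    constraint set. *)
Lemma first_order_optimality {R : realType} (f g : R -> R) (x z t0 : R) :
  derivable f x 1 -> convex_on_R g -> 0 < t0 <= 1 ->
  (forall t, 0 < t <= t0 -> f x + g x <= f (x + t * (z - x)) + g (x + t * (z - x))) ->
  - derive1 f x * (z - x) <= g z - g x.
Proof.
move=> df cg /andP[t00 t01] H.
suff : - (g z - g x) <= derive1 f x * (z - x) by lra.
apply: (@derive1_direction_ge R f x (z - x) _ 0 t0) => // t tt0.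
have {H} := H t tt0; have /andP[t0' tt] := tt0.
have := cg z x t; rewrite (ltW t0') (le_trans tt t01) => /(_ isT).
have -> : t * z + (1 - t) * x = x + t * (z - x) by ring.
by move=> ? ?; lra.
Qed.

(** * Proximal maps *)

(** Passes from firm nonexpansiveness of a map, or monotonicity of its inverse, to a Lipschitz
    bound. *)
Lemma sqr_le_mul_norm {R : realType} (a b : R) : a ^+ 2 <= a * b -> `|a| <= `|b|.
Proof.
move=> h; have [->|a0] := eqVneq a 0; first by rewrite normr0.
have : `|a| * `|a| <= `|a| * `|b|.
  rewrite -!normrM -expr2 ger0_norm ?sqr_ge0 //; exact: le_trans h (ler_norm _).
by rewrite ler_pM2l // normr_gt0.
Qed.

Lemma lipschitz_real_continuous {R : realType} (k : R) (p : R -> R) : 0 < k ->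
  (forall y z, `|p y - p z| <= k * `|y - z|) -> continuous p.
Proof.
move=> k0 H y; apply/cvgrPdist_le => e e0.
have ek : 0 < e / k by rewrite divr_gt0.
near=> z.
have : `|y - z| <= e / k.
  by near: z; apply: (@cvgr_dist_le _ _ _ (nbhs y) _ id y) => //; exact: cvg_id.
by rewrite ler_pdivlMr // mulrC; exact: le_trans.
Unshelve. all: by end_near. Qed.

Lemma derive1_half_sqr {R : realType} (y x : R) :
  derivable (fun z : R => (z - y) ^+ 2 / 2) x 1 /\
  derive1 (fun z : R => (z - y) ^+ 2 / 2) x = x - y.
Proof.
have H : is_derive x 1 (fun z : R => (z - y) ^+ 2 / 2) (x - y).
  have -> : (fun z : R => (z - y) ^+ 2 / 2) = (2^-1 \*: ((id - cst y) ^+ 2)).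
    by apply/funext => z; rewrite !fctE /= mulrC.
  by apply: is_derive_eq; rewrite /GRing.scale /= !fctE; field.
by split; [exact: ex_derive|rewrite derive1E; exact: derive_val].
Qed.

(** The half square exceeds its linearization at [p] by [(z - p) ^+ 2 / 2]. This surplus gives
    minimality and excludes any other minimizer. *)
Lemma prox_unique {R : realType} (g : R -> R) (y p : R) :
  subgradient g p (y - p) -> prox (fun x => (g x)%:E) y = p.
Proof.
move=> sg; rewrite /prox; apply: xget_unique.
  split; first by rewrite ltry.
  by move=> z; rewrite -!EFinD lee_fin; have := sg z; have := sqr_ge0 (z - p); nra.
move=> q [_ /(_ p)]; rewrite -!EFinD lee_fin => h.
have := sg q => h2.
have : (q - p) ^+ 2 <= 0 by nra.
by move=> h3; apply/eqP; rewrite -subr_eq0 -sqrf_eq0 eq_le h3 sqr_ge0.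
Qed.

Lemma prox_subgradient {R : realType} (g : R -> R) (y : R) : convex_on_R g ->
  subgradient g (prox (fun x => (g x)%:E) y) (y - prox (fun x => (g x)%:E) y).
Proof.
move=> cg.
have [s [sg _ _]] := convex_subgradient_near g y 0 cg.
(* At distance more than [2 * |s|] from [y], the half square outweighs the largest decrease the
   subgradient [s] at [y] allows. A minimum over [[y - r, y + r]] is therefore global. *)
pose r := 2 * `|s| + 1.
have r0 : 0 < r by rewrite ltr_wpDl // mulr_ge0.
have gc := convex_continuous g cg.
have hc : continuous (fun x => g x + (x - y) ^+ 2 / 2).
  move=> x; apply: cvgD; first exact: gc.
  apply: cvgM; last exact: cvg_cst.
  by apply: (cvgM (f := fun x => x - y)); apply: cvgB; [exact: cvg_id|exact: cvg_cst|exact: cvg_id|exact: cvg_cst].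
have [||p pin pmin] := @EVT_min R (fun x => g x + (x - y) ^+ 2 / 2) (y - r) (y + r).
- by lra.
- exact: continuous_subspaceT.
have pglob z : g p + (p - y) ^+ 2 / 2 <= g z + (z - y) ^+ 2 / 2.
  have [zin|] := boolP (z \in `[y - r, y + r]); first exact: pmin.
  rewrite in_itv /= negb_and -!ltNge => zout.
  have zr : r < `|z - y|.
    by case/orP: zout => h; [have := ler_norm (- (z - y)); rewrite normrN|have := ler_norm (z - y)]; lra.
  have := pmin y; rewrite in_itv /= => /(_ _)/le_trans; apply; first by apply/andP; split; lra.
  have := sg z.
  have : - (s * (z - y)) <= `|s| * `|z - y| by rewrite -normrM -normrN ler_norm.
  rewrite subrr expr0n /= mul0r addr0 -(real_normK (num_real (z - y))).
  by have := normr_ge0 s; rewrite /r in zr *; nra.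
suff sgp : subgradient g p (y - p) by rewrite (prox_unique _ _ _ sgp).
move=> z.
have [dh hE] := derive1_half_sqr y p.
have := @first_order_optimality R _ g p z 1 dh cg.
rewrite ltr01 lexx hE => /(_ isT) H.
suff : - (p - y) * (z - p) <= g z - g p by lra.
by apply: H => t _; rewrite addrC [leRHS]addrC; exact: pglob.
Qed.

(** Testing the subgradient inequality at each proximal point against the other one and adding shows
    that the map is firmly nonexpansive. *)
Lemma prox_continuous {R : realType} (g : R -> R) : convex_on_R g ->
  continuous (prox (fun x => (g x)%:E)).
Proof.
move=> cg; apply: (@lipschitz_real_continuous R 1) => // y z; rewrite mul1r.
have := prox_subgradient g y cg (prox (fun x => (g x)%:E) z).
have := prox_subgradient g z cg (prox (fun x => (g x)%:E) y).
by move=> h1 h2; apply: sqr_le_mul_norm; nra.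
Qed.

Lemma prox_itv_unique {R : realType} (lo hi y p : R) : lo <= p <= hi ->
  (forall z, lo <= z <= hi -> (y - p) * (z - p) <= 0) ->
  prox (indicator_itv lo hi) y = p.
Proof.
move=> pin H; rewrite /prox; apply: xget_unique.
  split => [|z]; rewrite /indicator_itv pin; first exact: ltry.
  case: ifPn => [zin|_]; last by rewrite addye // leey.
  by rewrite !add0e lee_fin; have := H z zin; have := sqr_ge0 (z - p); nra.
move=> q [+ /(_ p)]; rewrite /indicator_itv pin; case: ifPn => // qin _.
rewrite !add0e lee_fin => h; have := H q qin => h2.
have : (q - p) ^+ 2 <= 0 by nra.
by move=> h3; apply/eqP; rewrite -subr_eq0 -sqrf_eq0 eq_le h3 sqr_ge0.
Qed.

Lemma prox_itvP {R : realType} (lo hi y : R) : lo <= hi ->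
  lo <= prox (indicator_itv lo hi) y <= hi /\
  forall z, lo <= z <= hi ->
    (y - prox (indicator_itv lo hi) y) * (z - prox (indicator_itv lo hi) y) <= 0.
Proof.
move=> lohi; pose p := Num.max lo (Num.min y hi).
have pin : lo <= p <= hi by rewrite /p le_max lexx ge_max lohi ge_min lexx orbT.
have H z : lo <= z <= hi -> (y - p) * (z - p) <= 0.
  move=> /andP[lz zh]; rewrite /p.
  have [yh|hy] := leP y hi; have [ly|yl] := leP lo; nra.
by rewrite (prox_itv_unique _ _ _ _ pin H).
Qed.

Lemma prox_itv_continuous {R : realType} (lo hi : R) : lo <= hi ->
  continuous (prox (indicator_itv lo hi)).
Proof.
move=> lohi; apply: (@lipschitz_real_continuous R 1) => // y z; rewrite mul1r.
have [iny hy] := prox_itvP lo hi y lohi; have [inz hz] := prox_itvP lo hi z lohi.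
have := hy _ inz; have := hz _ iny.
by move=> h1 h2; apply: sqr_le_mul_norm; nra.
Qed.

(* [d] minimizes [f0 + f2 - m x] over [lo, hi], with [s] the subgradient of
   [f2] certifying it. *)
Definition node_optimum {R : realType} (lo hi : R) (f0 f2 : R -> R) (m d s : R) :=
  [/\ lo <= d <= hi, subgradient f2 d s &
      forall z, lo <= z <= hi -> (m - derive1 f0 d - s) * (z - d) <= 0].

(** A minimizer exists by compactness. Among the subgradients of [f2] there, the one closest to
    [m - derive1 f0 d] is taken: it is at least that value if [d < hi] and at most that value if
    [lo < d], which is the variational inequality. *)
Lemma node_optimum_exists {R : realType} (lo hi : R) (f0 f2 : R -> R) (m : R) :
  lo <= hi -> (forall x, derivable f0 x 1) -> convex_on_R f2 ->
  exists d s, node_optimum lo hi f0 f2 m d s.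
Proof.
move=> lohi df0 cf2.
pose f x := f0 x - m * x.
have df (x : R) : is_derive x 1 f (derive1 f0 x - m).
  have -> : f = f0 - m \*: id by apply/funext => z; rewrite !fctE.
  have ? : is_derive x 1 f0 (derive1 f0 x) by rewrite derive1E; apply: derivableP.
  by apply: is_derive_eq; rewrite /GRing.scale /= mulr1.
have fE x : derive1 f x = derive1 f0 x - m by rewrite derive1E; exact: derive_val.
have hc : continuous (fun x => f x + f2 x).
  move=> x; apply: cvgD; last exact: convex_continuous.
  by apply/differentiable_continuous/derivable1_diffP.
have [|d] := @EVT_min R (fun x => f x + f2 x) lo hi lohi; first exact: continuous_subspaceT.
rewrite in_itv /= => /andP[lod dhi] dmin.
have [s [sg sge sle]] := convex_subgradient_near f2 d (m - derive1 f0 d) cf2.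
have opt z t0 : 0 < t0 <= 1 -> lo <= d + t0 * (z - d) <= hi ->
    (m - derive1 f0 d) * (z - d) <= f2 z - f2 d.
  move=> t01 /andP[tl th]; have := @first_order_optimality R f f2 d z t0 _ cf2 t01.
  rewrite fE opprB; apply => // t /andP[t0' tt0]; apply: dmin; rewrite in_itv /=.
  by apply/andP; split; nra.
exists d, s; split => //; first by rewrite lod.
have hs : d < hi -> m - derive1 f0 d <= s.
  move=> dh; apply: sge => z dz.
  (* The point [z] ranges over the whole half-line, so the segment from [d] is cut where it would
     leave the interval. *)
  pose t0 := Num.min 1 ((hi - d) / (z - d)).
  have zd : 0 < z - d by rewrite subr_gt0.
  have t00 : 0 < t0 by rewrite lt_min ltr01 divr_gt0 // subr_gt0.
  have t0h : t0 * (z - d) <= hi - d by rewrite -ler_pdivlMr // ge_min lexx orbT.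
  apply: (opt z t0); first by rewrite t00 ge_min lexx.
  by apply/andP; split; nra.
have ls : lo < d -> s <= m - derive1 f0 d.
  move=> ld; apply: sle => z zd.
  pose t0 := Num.min 1 ((d - lo) / (d - z)).
  have dz : 0 < d - z by rewrite subr_gt0.
  have t00 : 0 < t0 by rewrite lt_min ltr01 divr_gt0 // subr_gt0.
  have t0h : t0 * (d - z) <= d - lo by rewrite -ler_pdivlMr // ge_min lexx orbT.
  apply: (opt z t0); first by rewrite t00 ge_min lexx.
  by apply/andP; split; nra.
move=> z /andP[lz zh]; have [dz|zd|->] := ltgtP d z; last by rewrite subrr mulr0.
- by have := hs (lt_le_trans dz zh); nra.
- by have := ls (le_lt_trans lz zd); nra.
Qed.

(** Each optimum is tested in the two inequalities of the other, and strong monotonicity of the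
    derivative of [f0] is added. Hence the optimal load is a nondecreasing Lipschitz function of the
    price. *)
Lemma node_optimum_monotone {R : realType} (lo hi beta : R) (f0 f2 : R -> R)
    (m d s m' d' s' : R) :
  0 <= beta -> strongly_convex beta f0 -> (forall x, derivable f0 x 1) ->
  node_optimum lo hi f0 f2 m d s -> node_optimum lo hi f0 f2 m' d' s' ->
  beta * (d - d') ^+ 2 <= (m - m') * (d - d').
Proof.
move=> b0 sc df [din sg H] [d'in sg' H'].
have := strongly_convex_monotone beta f0 d d' b0 sc (df d) (df d').
by have := sg d'; have := sg' d; have := H _ d'in; have := H' _ din; nra.
Qed.

(** * Divergence and Laplacian of a network *)

(** Outflow minus inflow: with this sign the Laplacian below is positive semidefinite for positive
    weights. *)
Definition divergence {R : realType} {n : nat} (E : rel 'I_n)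
    (F : 'I_n -> 'I_n -> R) (i : 'I_n) : R :=
  (\sum_(j < n | E i j) F i j) - (\sum_(k < n | E k i) F k i).

Definition laplacian {R : realType} {n : nat} (E : rel 'I_n)
    (B : 'I_n -> 'I_n -> R) (x : 'I_n -> R) : 'I_n -> R :=
  divergence E (fun i j => B i j * (x i - x j)).

Lemma eq_divergence {R : realType} {n : nat} (E : rel 'I_n)
    (F G : 'I_n -> 'I_n -> R) i :
  (forall i j, E i j -> F i j = G i j) -> divergence E F i = divergence E G i.
Proof.
by move=> H; congr (_ - _); apply: eq_bigr => j Eij; exact: H.
Qed.

Lemma divergenceB {R : realType} {n : nat} (E : rel 'I_n)
    (F G : 'I_n -> 'I_n -> R) i :
  divergence E F i - divergence E G i = divergence E (fun i j => F i j - G i j) i.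
Proof. by rewrite /divergence !sumrB; ring. Qed.

Lemma laplacianB {R : realType} {n : nat} (E : rel 'I_n)
    (B : 'I_n -> 'I_n -> R) (x y : 'I_n -> R) i :
  laplacian E B x i - laplacian E B y i = laplacian E B (fun i => x i - y i) i.
Proof. by rewrite divergenceB; apply: eq_divergence => j k _; ring. Qed.

(** Summation by parts: the adjoint of the divergence takes differences along lines. *)
Lemma sum_divergence {R : realType} {n : nat} (E : rel 'I_n)
    (F : 'I_n -> 'I_n -> R) (v : 'I_n -> R) :
  \sum_i v i * divergence E F i = \sum_i \sum_(j | E i j) F i j * (v i - v j).
Proof.
under eq_bigr do rewrite /divergence mulrBr !mulr_sumr.
under [RHS]eq_bigr => i _ do (under eq_bigr do rewrite mulrBr; rewrite sumrB).
rewrite !sumrB; congr (_ - _).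
  by apply: eq_bigr => i _; apply: eq_bigr => j _; rewrite mulrC.
rewrite (exchange_big_dep predT) //=.
by apply: eq_bigr => i _; apply: eq_bigr => j _; rewrite mulrC.
Qed.

Lemma sum_divergence1 {R : realType} {n : nat} (E : rel 'I_n)
    (F : 'I_n -> 'I_n -> R) : \sum_i divergence E F i = 0.
Proof.
have := sum_divergence E F (fun=> 1); under eq_bigr do rewrite mul1r; move=> ->.
by rewrite big1 // => i _; rewrite big1 // => j _; rewrite subrr mulr0.
Qed.

Lemma sum_laplacian {R : realType} {n : nat} (E : rel 'I_n)
    (B : 'I_n -> 'I_n -> R) (x y : 'I_n -> R) :
  \sum_i x i * laplacian E B y i =
  \sum_i \sum_(j | E i j) B i j * ((x i - x j) * (y i - y j)).
Proof.
rewrite sum_divergence; apply: eq_bigr => i _; apply: eq_bigr => j _; ring.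
Qed.

Lemma laplacian_sym {R : realType} {n : nat} (E : rel 'I_n)
    (B : 'I_n -> 'I_n -> R) (x y : 'I_n -> R) :
  \sum_i x i * laplacian E B y i = \sum_i laplacian E B x i * y i.
Proof.
under [RHS]eq_bigr do rewrite mulrC.
rewrite !sum_laplacian; apply: eq_bigr => i _; apply: eq_bigr => j _; ring.
Qed.

Lemma weakly_connected_const {R : realType} {n : nat} (E : rel 'I_n) (x : 'I_n -> R) :
  weakly_connected E -> (forall i j, E i j -> x i = x j) -> forall i j, x i = x j.
Proof.
move=> conn H i j; have /connectP[p + ->] := conn i j.
elim: p i => [|k p IH] i //= /andP[/orP[/H->|/H<-]]; exact: IH.
Qed.

(** The Dirichlet form of [x] vanishes and is a sum of nonnegative terms, so [x] has no jump along
    any line. *)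
Lemma laplacian_kernel {R : realType} {n : nat} (E : rel 'I_n)
    (B : 'I_n -> 'I_n -> R) (x : 'I_n -> R) :
  weakly_connected E -> (forall i j, E i j -> 0 < B i j) ->
  (forall i, laplacian E B x i = 0) -> forall i j, x i = x j.
Proof.
move=> conn B0 H; apply: weakly_connected_const conn _ => i j Eij.
have := sum_laplacian E B x x; rewrite big1 => [|k _]; last by rewrite H mulr0.
have t0 k l : E k l -> 0 <= B k l * ((x k - x l) * (x k - x l)).
  by move=> Ekl; rewrite mulr_ge0 ?(ltW (B0 _ _ Ekl)) // -expr2 sqr_ge0.
move=> /esym/eqP; rewrite psumr_eq0 => [|k _]; last by apply: sumr_ge0 => l; exact: t0.
move=> /allP/(_ i); rewrite mem_index_enum => /(_ isT); rewrite psumr_eq0; last exact: t0.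
move=> /allP/(_ j); rewrite mem_index_enum Eij => /(_ isT).
by rewrite /= mulf_eq0 (gt_eqF (B0 _ _ Eij)) -expr2 sqrf_eq0 subr_eq0 => /eqP.
Qed.

(* The Laplacian is symmetric with kernel the constants, so its image is the
   orthogonal complement of the constants. *)
Lemma laplacian_surjective {R : realType} {n : nat} (E : rel 'I_n)
    (B : 'I_n -> 'I_n -> R) (b : 'I_n -> R) :
  weakly_connected E -> (forall i j, E i j -> 0 < B i j) ->
  \sum_i b i = 0 -> exists x, forall i, laplacian E B x i = b i.
Proof.
move=> conn B0 b0.
pose e (j k : 'I_n) : R := (k == j)%:R.
pose L : 'M[R]_n := \matrix_(i, j) laplacian E B (e i) j.
have eE i (y : 'I_n -> R) : \sum_k e i k * y k = y i.
  rewrite (bigD1 i) //= big1 => [|k /negbTE ki]; last by rewrite /e ki mul0r.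
  by rewrite /e eqxx mul1r addr0.
have lapE i j : laplacian E B (e i) j = laplacian E B (e j) i.
  rewrite -(eE j (laplacian E B (e i))) laplacian_sym -(eE i (laplacian E B (e j))).
  by apply: eq_bigr => k _; rewrite mulrC.
have LE (x : 'I_n -> R) i : laplacian E B x i = \sum_j x j * L j i.
  rewrite -(eE i (laplacian E B x)) laplacian_sym.
  by apply: eq_bigr => j _; rewrite mulrC mxE lapE.
have Lsym i j : L i j = L j i by rewrite !mxE lapE.
pose bv : 'rV[R]_n := \row_i b i.
have : (bv <= L)%MS.
  (* Membership in the row space is tested against the cokernel. Its columns are annihilated by the
     symmetric [L], hence constant, and a constant is orthogonal to [b]. *)
  rewrite submxE; apply/eqP/rowP => k; rewrite mxE [RHS]mxE.
  have K i : laplacian E B (fun j => cokermx L j k) i = 0.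
    rewrite LE; have /matrixP/(_ i k) := mulmx_coker L; rewrite [LHS]mxE [RHS]mxE => cok; rewrite -[RHS]cok.
    by apply: eq_bigr => j _; rewrite mulrC Lsym.
  have C := laplacian_kernel E B _ conn B0 K.
  (* A reference bus [i0] names the constant value; without any bus the sum is empty. *)
  have [i0 _|no] := pickP 'I_n; last by rewrite big1 // => i; have := no i.
  under eq_bigr => i _ do rewrite mxE (C i i0).
  by rewrite -mulr_suml b0 mul0r.
move=> /submxP[x xE]; exists (fun i => x 0 i) => i; rewrite LE.
by have /rowP/(_ i) := xE; rewrite [LHS]mxE [RHS]mxE => ->.
Qed.

(** * Equilibria *)

Lemma u1_divergence {R : realType} {n : nat} (E : rel 'I_n) (Pin D d w : 'I_n -> R)
    (P : 'I_n -> 'I_n -> R) i :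
  u1 E Pin D d w P i = Pin i - d i - D i * w i - divergence E P i.
Proof. by rewrite /u1 /divergence; ring. Qed.

Lemma u2_laplacian {R : realType} {n : nat} (E : rel 'I_n) (B : 'I_n -> 'I_n -> R)
    (Pin d th : 'I_n -> R) i :
  u2 E B Pin d th i = Pin i - d i - laplacian E B th i.
Proof. by rewrite /u2 /laplacian /divergence; ring. Qed.

Lemma rhs_th_laplacian {R : realType} {n : nat} (E : rel 'I_n) (B : 'I_n -> 'I_n -> R)
    (Pin d th mu : 'I_n -> R) i :
  rhs_th E B Pin d th mu i = laplacian E B (fun j => mu j + u2 E B Pin d th j) i.
Proof.
by congr (_ - _); apply: eq_bigr => j _; congr (_ * _); ring.
Qed.

Lemma cvg_sumr {R : realType} {I T : Type} (F : set_system T) (FF : Filter F)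
    (r : seq I) (Q : pred I) (f : I -> T -> R) (l : I -> R) :
  (forall i, Q i -> f i t @[t --> F] --> l i) ->
  \sum_(i <- r | Q i) f i t @[t --> F] --> \sum_(i <- r | Q i) l i.
Proof. by move=> H; apply: cvg_big => //; exact: add_continuous. Qed.

Section network.
Context {R : realType} {n : nat} (E : rel 'I_n) (B : 'I_n -> 'I_n -> R)
  (D Pin lo hi : 'I_n -> R) (f0 f2 : 'I_n -> R -> R) (beta kappa : R).
Hypothesis Hconn : weakly_connected E.
Hypothesis HB : forall i j, E i j -> 0 < B i j.
Hypothesis HD : forall i, 0 < D i.
Hypothesis Hkappa : 0 < kappa < 1.
Hypothesis Hf0d : forall i x, derivable (f0 i) x 1.
Hypothesis Hf2cvx : forall i, convex_on_R (f2 i).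
Hypothesis Hbeta : 1 < beta.
Hypothesis Hf0sc : forall i, strongly_convex beta (f0 i).
Hypothesis Hlohi : forall i, lo i <= hi i.

Local Notation equilibrium := (dppd_equilibrium E B Pin D lo hi f0 f2 kappa).

Let beta0 : 0 <= beta. Proof. exact: le_trans ler01 (ltW Hbeta). Qed.

(* Summing [u1 = 0] and [u2 = 0] over the network gives [sum_i D i * lam i = 0];
   as [lam] is constant along lines, it vanishes. *)
Lemma equilibriumP (eta d th : 'I_n -> R) (P : 'I_n -> 'I_n -> R) (lam mu : 'I_n -> R) :
  equilibrium eta d th P lam mu <->
  [/\ forall i, node_optimum (lo i) (hi i) (f0 i) (f2 i) (mu i) (d i) (- (kappa * eta i)),
      forall i j, mu i = mu j, forall i, lam i = 0,
      forall i, laplacian E B th i = Pin i - d i &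
      forall i, divergence E P i = Pin i - d i].
Proof.
split.
- move=> [Heta [Hd [Hth [HP [Hlam Hmu]]]]].
  have U1 i : u1 E Pin D d lam P i = 0.
    by have := Hlam i; rewrite /rhs_lam => /eqP; rewrite mulf_eq0 invr_eq0 pnatr_eq0 orbF => /eqP.
  have U2 i : u2 E B Pin d th i = 0.
    by have := Hmu i; rewrite /rhs_mu => /eqP; rewrite mulf_eq0 invr_eq0 pnatr_eq0 orbF => /eqP.
  have th_lap i : laplacian E B th i = Pin i - d i by have := U2 i; rewrite u2_laplacian; lra.
  have muC : forall i j, mu i = mu j.
    apply: (laplacian_kernel E B) => // i.
    have := Hth i; rewrite rhs_th_laplacian => <-.
    by apply: eq_divergence => j k _; rewrite !U2 !addr0.
  have lamC : forall i j, lam i = lam j.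
    apply: (weakly_connected_const E) => // i j Eij.
    by have := HP i j Eij; rewrite /rhs_P !U1; lra.
  have lam0 i : lam i = 0.
    have : \sum_j u1 E Pin D d lam P j - \sum_j u2 E B Pin d th j = 0.
      by rewrite !big1 ?subrr.
    rewrite -sumrB.
    under eq_bigr => j _ do rewrite u1_divergence u2_laplacian (lamC j i).
    have -> : \sum_j (Pin j - d j - D j * lam i - divergence E P j -
        (Pin j - d j - laplacian E B th j)) =
      - (\sum_j D j) * lam i - \sum_j divergence E P j + \sum_j laplacian E B th j.
      rewrite mulNr mulr_suml -!sumrN -!big_split /=; apply: eq_bigr => j _; ring.
    rewrite !sum_divergence1 subr0 addr0 => /eqP; rewrite mulf_eq0 oppr_eq0.
    rewrite gt_eqF ?orFb => [/eqP //|].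
    by rewrite (bigD1 i) //= ltr_pwDl // sumr_ge0 // => j _; exact: ltW.
  split => // i; last by have := U1 i; rewrite u1_divergence lam0; lra.
  have /eqP := Heta i; rewrite subr_eq0 => /eqP etaE.
  have /eqP := Hd i; rewrite subr_eq0 => /eqP dE.
  have [] := prox_itvP (lo i) (hi i)
    (d i - derive1 (f0 i) (d i) + kappa * eta i + lam i + u1 E Pin D d lam P i
       + mu i + u2 E B Pin d th i) (Hlohi i).
  rewrite dE => din H; split => //.
    have := prox_subgradient (f2 i) (d i - kappa * eta i) (Hf2cvx i).
    by rewrite etaE; congr subgradient; ring.
  by move=> z /H; rewrite lam0 U1 U2; congr (_ * _ <= _); ring.
- move=> [Hopt muC lam0 HL HP].
  have U1 i : u1 E Pin D d lam P i = 0 by rewrite u1_divergence lam0 HP; ring.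
  have U2 i : u2 E B Pin d th i = 0 by rewrite u2_laplacian HL; ring.
  split=> [i|].
    rewrite /rhs_eta (prox_unique (f2 i) _ (d i)) ?subrr //.
    by have [_ + _] := Hopt i; congr subgradient; ring.
  split=> [i|].
    rewrite /rhs_d (prox_itv_unique _ _ _ (d i)) ?subrr //.
      by have [] := Hopt i.
    have [_ _ H] := Hopt i; move=> z /H; rewrite lam0 U1 U2; congr (_ * _ <= _); ring.
  split=> [i|].
    rewrite rhs_th_laplacian /laplacian /divergence !big1 ?subrr // => j _;
    by rewrite !U2 (muC i j) subrr mulr0.
  split=> [i j _|]; first by rewrite /rhs_P !U1 !lam0; ring.
  by split=> i; rewrite ?/rhs_lam ?/rhs_mu ?U1 ?U2 mul0r.
Qed.

(** The total load [F m] at the common price [m] is continuous and nondecreasing. It is bracketed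
    because each [c i] is optimal at a price [mc i] of its own and all these prices lie in
    [[- M, M]]. *)
Lemma node_optimum_sum (c : 'I_n -> R) : (forall i, lo i <= c i <= hi i) ->
  exists (m : R) (d s : 'I_n -> R),
    (forall i, node_optimum (lo i) (hi i) (f0 i) (f2 i) m (d i) (s i)) /\
    \sum_i d i = \sum_i c i.
Proof.
move=> cin.
have ex (i : 'I_n) : exists ds : R -> R * R, forall m,
    node_optimum (lo i) (hi i) (f0 i) (f2 i) m (ds m).1 (ds m).2.
  have [m|ds dsP] := @choice R (R * R)%type
    (fun m ds => node_optimum (lo i) (hi i) (f0 i) (f2 i) m ds.1 ds.2); last by exists ds.
  have [d [s H]] := node_optimum_exists _ _ _ _ m (Hlohi i) (Hf0d i) (Hf2cvx i).
  by exists (d, s).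
have [ds dsP] := choice ex.
have exc (i : 'I_n) : exists m, exists s, node_optimum (lo i) (hi i) (f0 i) (f2 i) m (c i) s.
  have [s [sg _ _]] := convex_subgradient_near (f2 i) (c i) 0 (Hf2cvx i).
  (* The price is read off from the stationarity equation at [c i], so the variational inequality
     holds with its first factor equal to 0. *)
  exists (derive1 (f0 i) (c i) + s), s; split => // z _.
  by rewrite (_ : _ - _ - _ = 0) ?mul0r //; ring.
have [mc mcP] := choice exc.
pose M := \sum_i `|mc i|.
have mcM i : `|mc i| <= M by rewrite /M (bigD1 i) //= lerDl sumr_ge0.
have M0 : 0 <= M by rewrite sumr_ge0.
pose F m := \sum_i (ds i m).1.
have Fc : continuous F.
  move=> m; apply: cvg_sumr => i _.
  apply: (@lipschitz_real_continuous R 1) => // y z; rewrite mul1r.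
  apply: sqr_le_mul_norm.
  have := node_optimum_monotone _ _ _ _ _ _ _ _ _ _ _ beta0 (Hf0sc i) (Hf0d i) (dsP i y) (dsP i z).
  rewrite [X in _ -> _ <= X]mulrC; apply: le_trans.
  by rewrite ler_peMl ?sqr_ge0 // ltW.
have cmp i m : (mc i <= m -> c i <= (ds i m).1) /\ (m <= mc i -> (ds i m).1 <= c i).
  have [s sP] := mcP i.
  have := node_optimum_monotone _ _ _ _ _ _ _ _ _ _ _ beta0 (Hf0sc i) (Hf0d i) (dsP i m) sP.
  move=> mon; split => h; rewrite leNgt; apply/negP => lt; have b1 := Hbeta.
    have : 0 < (c i - (ds i m).1) ^+ 2 by rewrite exprn_gt0 // subr_gt0.
    by nra.
  have : 0 < ((ds i m).1 - c i) ^+ 2 by rewrite exprn_gt0 // subr_gt0.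
  by nra.
have [|||m _ FmE] := @IVT R F (- M) M (\sum_i c i).
- by lra.
- exact: continuous_subspaceT.
- rewrite ge_min le_max; apply/andP; split; apply/orP; [left|right]; apply: ler_sum => i _.
    by have [_] := cmp i (- M); apply; have := mcM i; rewrite ler_norml => /andP[].
  by have [+ _] := cmp i M; apply; exact: le_trans (ler_norm _) (mcM i).
by exists m, (fun i => (ds i m).1), (fun i => (ds i m).2); split.
Qed.

(** Balance of [c] means that its total is that of [Pin]. A load [d] with the same total leaves
    [Pin - d] of zero sum, hence in the image of the Laplacian. *)
Lemma equilibrium_exists (c tht : 'I_n -> R) :
  (forall i, lo i <= c i <= hi i) -> (forall i, u2 E B Pin c tht i = 0) ->
  exists (eta d th : 'I_n -> R) (P : 'I_n -> 'I_n -> R) (lam mu : 'I_n -> R),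
    equilibrium eta d th P lam mu.
Proof.
move=> cin cbal; have [m [d [s [dopt dsum]]]] := node_optimum_sum c cin.
have [|th thE] := laplacian_surjective E B (fun i => Pin i - d i) Hconn HB.
  rewrite sumrB dsum -sumrB -[RHS](sum_divergence1 E (fun i j => B i j * (tht i - tht j))).
  by apply: eq_bigr => i _; have := cbal i; rewrite u2_laplacian /laplacian; lra.
(* [eta] encodes the subgradient of [f2] through [- (kappa * eta i) = s i], and the flows induced by
   the angles [th] serve both balance equations at once. *)
exists (fun i => - s i / kappa), d, th, (fun i j => B i j * (th i - th j)), (fun=> 0), (fun=> m).
apply/equilibriumP; split => // i.
have -> : - (kappa * (- s i / kappa)) = s i.
  by have /andP[k0 _] := Hkappa; field; rewrite gt_eqF.
exact: dopt.
Qed.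

Lemma rolc_cost_fin (d w : 'I_n -> R) : (forall i, lo i <= d i <= hi i) ->
  rolc_cost f0 f2 lo hi D d w =
  (\sum_i (f0 i (d i) + f2 i (d i) + D i / 2 * w i ^+ 2))%:E.
Proof.
move=> din; rewrite /rolc_cost -sumEFin; apply: eq_bigr => i _.
by rewrite /indicator_itv din adde0 -!EFinD.
Qed.

Lemma rolc_cost_infty (d w : 'I_n -> R) i : ~~ (lo i <= d i <= hi i) ->
  rolc_cost f0 f2 lo hi D d w = +oo%E.
Proof.
move=> dout; rewrite /rolc_cost (bigD1 i) //= /indicator_itv (negbTE dout).
(* The infinite term absorbs the other summands once their sum is known not to be [-oo]. *)
rewrite addeC; set S := (X in (X + _)%E).
have : S != -oo%E.
  rewrite /S; apply: (big_ind (fun x : \bar R => x != -oo%E)) => //.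
    by move=> x y; case: x; case: y.
  by move=> j _; case: ifP.
by case: S.
Qed.

(** Sufficiency of the first-order conditions, with the common value of [mu] as multiplier of the
    balance. Tangent, subgradient and variational inequalities add up bus by bus, and the frequency
    cost is 0 at the equilibrium. *)
Lemma equilibrium_optimal (eta d th : 'I_n -> R) (P : 'I_n -> 'I_n -> R) (lam mu : 'I_n -> R) :
  equilibrium eta d th P lam mu ->
  rolc_optimal E B Pin D lo hi f0 f2 d th lam P.
Proof.
move=> /equilibriumP[opt muC lam0 HL HP].
have din i : lo i <= d i <= hi i by have [] := opt i.
split; first by move=> i; rewrite u1_divergence u2_laplacian HL HP lam0; split; ring.
split; first by rewrite rolc_cost_fin // ltry.
move=> d' th' w' P' feas.
have [/forallP d'in|/forallPn[i]] := boolP [forall i, lo i <= d' i <= hi i]; last first.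
  by move=> /rolc_cost_infty ->; rewrite leey.
rewrite !rolc_cost_fin // lee_fin.
(* All feasible loads have the same total, since Laplacians sum to zero, and [mu] is constant. *)
suff : \sum_i mu i * (d' i - d i) = 0.
  move=> mu0; rewrite -subr_ge0 -sumrB -[leLHS]mu0; apply: ler_sum => i _.
  have [_ sg VI] := opt i.
  have := strongly_convex_tangent _ _ _ (d' i) beta0 (Hf0sc i) (Hf0d i (d i)).
  have := sg (d' i); have := VI _ (d'in i); have := sqr_ge0 (d' i - d i).
  have : 0 <= D i / 2 * w' i ^+ 2 by rewrite mulr_ge0 ?sqr_ge0 // divr_ge0 // ltW.
  by rewrite lam0; have := beta0; nra.
have E0 : \sum_i (d' i - d i) = 0.
  have : \sum_i (laplacian E B th i - laplacian E B th' i) = 0.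
    by rewrite sumrB !sum_divergence1 subrr.
  move=> S0; rewrite -[RHS]S0; apply: eq_bigr => i _; have [_] := feas i; rewrite u2_laplacian HL; lra.
have [i0 _|no] := pickP 'I_n; last by rewrite big1 // => i; have := no i.
by under eq_bigr => i _ do rewrite (muC i i0); rewrite -mulr_sumr E0 mulr0.
Qed.

End network.

(** * The Lyapunov function *)

Lemma is_derive_sumr {R : realType} {I : Type} (r : seq I) (Q : pred I)
    (f : I -> R -> R) (df : I -> R) (t : R) :
  (forall i, Q i -> is_derive t 1 (f i) (df i)) ->
  is_derive t 1 (fun s => \sum_(i <- r | Q i) f i s) (\sum_(i <- r | Q i) df i).
Proof.
move=> H; elim: r => [|i r IH].
  rewrite big_nil (_ : (fun _ => _) = cst 0); first exact: is_derive_cst.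
  by apply/funext => s; rewrite big_nil.
rewrite big_cons; under eq_fun do rewrite big_cons.
by case: ifP => // /H Hi; exact: is_deriveD.
Qed.

(* [e], [x], [m], [y] are the deviations of [eta], [d], [mu], [th] from the
   equilibrium, [l] is [lam], whose equilibrium value is [0], [u] and [v] are
   [u1] and [u2], and [b] is the Bregman divergence of [f0]. *)
Definition node_lyapunov {R : realType} (kappa D e x m y l u v b : R) : R :=
  x ^+ 2 / 2 + b + kappa * e ^+ 2 / 2 - kappa * (e * x)
  + (m + v) ^+ 2 / 2 + m ^+ 2 / 2 + y ^+ 2 / 2
  + (l + u) ^+ 2 / 2 + l ^+ 2 / 2 + 3 * D * l ^+ 2 / 2.

(** The time derivative of [node_lyapunov], where [g] is the derivative of the Bregman term with
    respect to the load. *)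
Definition node_rate {R : realType} (kappa D e x m y l u v g de dx dm dy dl du dv : R) : R :=
  x * dx + g * dx + kappa * (e * de) - kappa * (de * x + e * dx)
  + (m + v) * (dm + dv) + m * dm + y * dy
  + (l + u) * (dl + du) + l * dl + 3 * D * (l * dl).

Lemma is_derive_node_lyapunov {R : realType} (kappa D t : R)
    (e x m y l u v b : R -> R) (es xs ms ys g de dx dm dy dl du dv : R) :
  is_derive t 1 e de -> is_derive t 1 x dx -> is_derive t 1 m dm ->
  is_derive t 1 y dy -> is_derive t 1 l dl -> is_derive t 1 u du ->
  is_derive t 1 v dv -> is_derive t 1 b (g * dx) ->
  is_derive t 1 (fun s => node_lyapunov kappa D (e s - es) (x s - xs) (m s - ms)
                   (y s - ys) (l s) (u s) (v s) (b s))
    (node_rate kappa D (e t - es) (x t - xs) (m t - ms) (y t - ys) (l t) (u t) (v t) g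
       de dx dm dy dl du dv).
Proof.
move=> He Hx Hm Hy Hl Hu Hv Hb; rewrite /node_lyapunov.
by apply: is_derive_eq; rewrite /node_rate /GRing.scale /=; field.
Qed.

(** Strong convexity with [beta > 1] turns [x ^+ 2 / 2 + b] into at least [x ^+ 2]. The cross term
    is absorbed by [kappa * (e / 2 - x) ^+ 2], leaving [kappa / 4 * e ^+ 2] and
    [(1 - kappa) * x ^+ 2]. *)
Lemma node_lyapunov_ge {R : realType} (kappa beta D e x m y l u v b : R) :
  0 < kappa < 1 -> 1 < beta -> 0 < D -> beta / 2 * x ^+ 2 <= b ->
  kappa * (1 - kappa) / 4 * (e ^+ 2 + x ^+ 2 + y ^+ 2 + l ^+ 2 + m ^+ 2) <=
  node_lyapunov kappa D e x m y l u v b.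
Proof.
move=> /andP[k0 k1] b1 D0 hb; rewrite /node_lyapunov.
have kk : 0 <= kappa * (1 - kappa) by rewrite mulr_ge0 ?subr_ge0 // ltW.
have h1 : x ^+ 2 <= beta * x ^+ 2 by rewrite ler_peMl ?sqr_ge0 // ltW.
have h2 := sqr_ge0 (m + v); have h3 := sqr_ge0 (l + u).
have h4 : 0 <= D * l ^+ 2 by rewrite mulr_ge0 ?sqr_ge0 // ltW.
have h5 : 0 <= kappa * (e / 2 - x) ^+ 2 by rewrite mulr_ge0 ?sqr_ge0 // ltW.
have q (z : R) : kappa * (1 - kappa) / 4 * z ^+ 2 <= 1 / 2 * z ^+ 2.
  by apply: ler_wpM2r; [exact: sqr_ge0|nra].
have qx : kappa * (1 - kappa) / 4 * x ^+ 2 <= (1 - kappa) * x ^+ 2.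
  by apply: ler_wpM2r; [exact: sqr_ge0|nra].
have qe : kappa * (1 - kappa) / 4 * e ^+ 2 <= kappa / 4 * e ^+ 2.
  by apply: ler_wpM2r; [exact: sqr_ge0|nra].
have := q y; have := q l; have := q m => *; lra.
Qed.

(* [hd] combines the variational inequalities of the projection at the state and
   at the equilibrium, [he] is monotonicity of the subdifferential of [f2]. *)
Lemma node_rate_le {R : realType} (kappa beta D e x m y l u v g de dx dy Lr Lt Cr Cp : R) :
  0 < kappa < 1 -> 1 < beta -> 0 < D -> beta * x ^+ 2 <= g * x ->
  v = - x - Lt -> u = - x - D * l - Cp ->
  forall (hd : (g - kappa * e - l - u - m - v + dx) * (dx + x) <= 0)
    (he : 0 <= (- (kappa * e) - de) * (x + de)),
  node_rate kappa D e x m y l u v g de dx (v / 2) dy (u / 2)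
    (- dx - D * (u / 2) - Cr) (- dx - Lr) <=
  - ((1 - kappa) / 2 * (dx ^+ 2 + de ^+ 2) + v ^+ 2 / 2 + u ^+ 2 / 2)
  + (y * dy - (m + v) * (Lr + Lt)) - (l + u) * (Cr + Cp).
Proof.
move=> /andP[k0 k1] b1 D0 hg Ev Eu hd he; rewrite /node_rate.
have -> : Lt = - x - v by rewrite Ev; ring.
have -> : Cp = - x - D * l - u by rewrite Eu; ring.
clear Ev Eu Lt Cp.
(* After adding [hd] and [he], the products [e * x] cancel thanks to the cross term of
   [node_lyapunov]. The form [x ^+ 2 + (1 + kappa) * x * de + de ^+ 2] left over splits into
   [(1 + kappa) / 2 * (x + de) ^+ 2] and [(1 - kappa) / 2 * (x ^+ 2 + de ^+ 2)]. The weight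
   [3 * D / 2] on [l ^+ 2] cancels the products [D * l * u]. *)
have h1 : x ^+ 2 <= beta * x ^+ 2 by rewrite ler_peMl ?sqr_ge0 // ltW.
have h2 : 0 <= (1 + kappa) / 2 * (x + de) ^+ 2.
  by rewrite mulr_ge0 ?sqr_ge0 //; lra.
have h3 : 0 <= (1 - kappa) / 2 * x ^+ 2 by rewrite mulr_ge0 ?sqr_ge0 //; lra.
have h4 : 0 <= D * l ^+ 2 by rewrite mulr_ge0 ?sqr_ge0 // ltW.
have h5 : 0 <= D * u ^+ 2 by rewrite mulr_ge0 ?sqr_ge0 // ltW.
have h6 : 0 <= (1 + kappa) / 2 * dx ^+ 2 by rewrite mulr_ge0 ?sqr_ge0 //; lra.
lra.
Qed.

(** * States of the network, the vector field and its dissipation *)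

Record state (R : realType) (n : nat) := State {
  s_eta : 'I_n -> R; s_d : 'I_n -> R; s_th : 'I_n -> R;
  s_P : 'I_n -> 'I_n -> R; s_lam : 'I_n -> R; s_mu : 'I_n -> R }.
Arguments State {R n}.
Arguments s_eta {R n}.
Arguments s_d {R n}.
Arguments s_th {R n}.
Arguments s_P {R n}.
Arguments s_lam {R n}.
Arguments s_mu {R n}.

Section lyapunov.
Context {R : realType} {n : nat} (E : rel 'I_n) (B : 'I_n -> 'I_n -> R)
  (D Pin lo hi : 'I_n -> R) (f0 f2 : 'I_n -> R -> R) (beta kappa : R).
Hypothesis Hconn : weakly_connected E.
Hypothesis HB : forall i j, E i j -> 0 < B i j.
Hypothesis HD : forall i, 0 < D i.
Hypothesis Hkappa : 0 < kappa < 1.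
Hypothesis Hf0d : forall i x, derivable (f0 i) x 1.
Hypothesis Hf2cvx : forall i, convex_on_R (f2 i).
Hypothesis Hbeta : 1 < beta.
Hypothesis Hf0sc : forall i, strongly_convex beta (f0 i).
Hypothesis Hlohi : forall i, lo i <= hi i.

Local Notation state := (state R n).

Definition injection1 (x : state) : 'I_n -> R := u1 E Pin D (s_d x) (s_lam x) (s_P x).
Definition injection2 (x : state) : 'I_n -> R := u2 E B Pin (s_d x) (s_th x).

Definition vector_field (x : state) : state := State
  (rhs_eta f2 kappa (s_eta x) (s_d x))
  (rhs_d E B Pin D lo hi f0 kappa (s_eta x) (s_d x) (s_th x) (s_P x) (s_lam x) (s_mu x))
  (rhs_th E B Pin (s_d x) (s_th x) (s_mu x))
  (rhs_P E Pin D (s_d x) (s_P x) (s_lam x))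
  (rhs_lam E Pin D (s_d x) (s_P x) (s_lam x))
  (rhs_mu E B Pin (s_d x) (s_th x)).

Definition state_sub (x y : state) : state := State
  (fun i => s_eta x i - s_eta y i) (fun i => s_d x i - s_d y i)
  (fun i => s_th x i - s_th y i) (fun i j => s_P x i j - s_P y i j)
  (fun i => s_lam x i - s_lam y i) (fun i => s_mu x i - s_mu y i).

(** Flows enter along lines only: off [E] the entries of [s_P] are arbitrary. *)
Definition sqnorm (x : state) : R :=
  \sum_i (s_eta x i ^+ 2 + s_d x i ^+ 2 + s_th x i ^+ 2 + s_lam x i ^+ 2 + s_mu x i ^+ 2)
  + \sum_i \sum_(j | E i j) s_P x i j ^+ 2.

Definition is_equilibrium (x : state) : Prop :=
  dppd_equilibrium E B Pin D lo hi f0 f2 kappa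
    (s_eta x) (s_d x) (s_th x) (s_P x) (s_lam x) (s_mu x).

Definition bregman (f : R -> R) (x y : R) : R := f x - f y - derive1 f y * (x - y).

Definition lyapunov (xs x : state) : R :=
  \sum_i node_lyapunov kappa (D i) (s_eta x i - s_eta xs i) (s_d x i - s_d xs i)
    (s_mu x i - s_mu xs i) (s_th x i - s_th xs i) (s_lam x i)
    (injection1 x i) (injection2 x i) (bregman (f0 i) (s_d x i) (s_d xs i))
  + \sum_i \sum_(j | E i j) (s_P x i j - s_P xs i j) ^+ 2 / 2.

(** The last two arguments of [node_rate] are the derivatives of [injection1] and [injection2] along
    the field, which are affine in the state. *)
Definition lyapunov_rate (xs x : state) : R :=
  let F := vector_field x in
  \sum_i node_rate kappa (D i) (s_eta x i - s_eta xs i) (s_d x i - s_d xs i)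
    (s_mu x i - s_mu xs i) (s_th x i - s_th xs i) (s_lam x i)
    (injection1 x i) (injection2 x i)
    (derive1 (f0 i) (s_d x i) - derive1 (f0 i) (s_d xs i))
    (s_eta F i) (s_d F i) (s_mu F i) (s_th F i) (s_lam F i)
    (- s_d F i - D i * s_lam F i - divergence E (s_P F) i)
    (- s_d F i - laplacian E B (s_th F) i)
  + \sum_i \sum_(j | E i j) (s_P x i j - s_P xs i j) * s_P F i j.

Let c : R := kappa * (1 - kappa) / 4.

Let k0 : 0 < kappa. Proof. by case/andP: Hkappa. Qed.
Let k1 : kappa < 1. Proof. by case/andP: Hkappa. Qed.
Let beta0 : 0 <= beta. Proof. exact: le_trans ler01 (ltW Hbeta). Qed.

Lemma lyapunov_constant_gt0 : 0 < c.
Proof. by rewrite !divr_gt0 ?mulr_gt0 // subr_gt0. Qed.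

Lemma sqnorm_ge0 x : 0 <= sqnorm x.
Proof.
by rewrite addr_ge0 ?sumr_ge0 // => i _; [rewrite !addr_ge0 ?sqr_ge0|apply: sumr_ge0 => j _; exact: sqr_ge0].
Qed.

Lemma sqnorm_ge_node x i :
  s_eta x i ^+ 2 + s_d x i ^+ 2 + s_th x i ^+ 2 + s_lam x i ^+ 2 + s_mu x i ^+ 2 <= sqnorm x.
Proof.
rewrite /sqnorm (bigD1 i) //= -[leRHS]addrA lerDl addr_ge0 ?sumr_ge0 // => j _.
  by rewrite !addr_ge0 ?sqr_ge0.
by apply: sumr_ge0 => k _; exact: sqr_ge0.
Qed.

Lemma sqnorm_ge_line x i j : E i j -> s_P x i j ^+ 2 <= sqnorm x.
Proof.
move=> Eij; apply: ler_wpDl.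
  by apply: sumr_ge0 => k _; rewrite !addr_ge0 ?sqr_ge0.
rewrite (bigD1 i) //= (bigD1 j) //= -[leRHS]addrA lerDl addr_ge0 ?sumr_ge0 // => k _.
  exact: sqr_ge0.
by apply: sumr_ge0 => l _; exact: sqr_ge0.
Qed.

Lemma is_equilibriumP xs : is_equilibrium xs ->
  [/\ forall i, node_optimum (lo i) (hi i) (f0 i) (f2 i) (s_mu xs i) (s_d xs i)
        (- (kappa * s_eta xs i)),
      forall i j, s_mu xs i = s_mu xs j, forall i, s_lam xs i = 0,
      forall i, laplacian E B (s_th xs) i = Pin i - s_d xs i &
      forall i, divergence E (s_P xs) i = Pin i - s_d xs i].
Proof. by move=> Hxs; apply/equilibriumP. Qed.

Lemma lyapunov_ge xs x : is_equilibrium xs ->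
  c * sqnorm (state_sub x xs) <= lyapunov xs x.
Proof.
move=> /is_equilibriumP[_ _ lam0 _ _].
rewrite /sqnorm mulrDr lerD // mulr_sumr; apply: ler_sum => i _ /=.
  rewrite lam0 subr0; apply: (node_lyapunov_ge _ beta) => //.
  have := strongly_convex_tangent beta (f0 i) (s_d xs i) (s_d x i) beta0 (Hf0sc i) (Hf0d i _).
  by rewrite /bregman; lra.
rewrite mulr_sumr; apply: ler_sum => j _.
by rewrite mulrC; apply: ler_wpM2l; [exact: sqr_ge0|rewrite /c; have := k0; have := k1; nra].
Qed.

(** The terms in which [node_rate_le] couples a bus to its neighbours have no sign at a single bus.
    Summed over the network, symmetry of the Laplacian and summation by parts turn them into minus
    the squares of the rates of [th] and [P], and the remaining products cancel. *)
Lemma lyapunov_rate_le xs x : is_equilibrium xs ->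
  lyapunov_rate xs x <= - (c * sqnorm (vector_field x)).
Proof.
move=> /is_equilibriumP[opt muC lam0 HL HP].
pose F := vector_field x.
pose v := injection2 x; pose u := injection1 x.
pose nu i := s_mu x i - s_mu xs i + v i.
pose rho i := s_lam x i + u i.
have vE i : v i = - (s_d x i - s_d xs i)
    - laplacian E B (fun j => s_th x j - s_th xs j) i.
  by rewrite /v /injection2 u2_laplacian -laplacianB HL; ring.
have uE i : u i = - (s_d x i - s_d xs i) - D i * s_lam x i
    - divergence E (fun j k => s_P x j k - s_P xs j k) i.
  by rewrite /u /injection1 u1_divergence -divergenceB HP; ring.
(* The equilibrium value of [mu] is constant, so the Laplacian does not see the passage to the
   deviation. *)
have FthE i : s_th F i = laplacian E B nu i.
  rewrite /F /= rhs_th_laplacian; apply: eq_divergence => j k _.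
  by rewrite /nu (muC j k) /v /injection2; ring.
have FPE i j : s_P F i j = rho i - rho j by rewrite /F /rho /u /injection1 /= /rhs_P; ring.
have node i : node_rate kappa (D i) (s_eta x i - s_eta xs i) (s_d x i - s_d xs i)
    (s_mu x i - s_mu xs i) (s_th x i - s_th xs i) (s_lam x i) (u i) (v i)
    (derive1 (f0 i) (s_d x i) - derive1 (f0 i) (s_d xs i))
    (s_eta F i) (s_d F i) (s_mu F i) (s_th F i) (s_lam F i)
    (- s_d F i - D i * s_lam F i - divergence E (s_P F) i)
    (- s_d F i - laplacian E B (s_th F) i) <=
  - ((1 - kappa) / 2 * (s_d F i ^+ 2 + s_eta F i ^+ 2) + v i ^+ 2 / 2 + u i ^+ 2 / 2)
  + ((s_th x i - s_th xs i) * s_th F i - nu i * (laplacian E B (s_th F) i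
       + laplacian E B (fun j => s_th x j - s_th xs j) i))
  - rho i * (divergence E (s_P F) i + divergence E (fun j k => s_P x j k - s_P xs j k) i).
  have [dsin sgs VIs] := opt i.
  apply: (node_rate_le _ beta) => //.
  - exact: strongly_convex_monotone.
  - have [] := prox_itvP (lo i) (hi i)
      (s_d x i - derive1 (f0 i) (s_d x i) + kappa * s_eta x i + s_lam x i + u i
       + s_mu x i + v i) (Hlohi i).
    set p := prox _ _ => pin pVI.
    have -> : s_d F i = p - s_d x i by [].
    have := pVI _ dsin; have := VIs _ pin; nra.
  - have := prox_subgradient (f2 i) (s_d x i - kappa * s_eta x i) (Hf2cvx i).
    set p := prox _ _ => sg.
    have -> : s_eta F i = p - s_d x i by [].
    have := sg (s_d xs i); have := sgs p; nra.
have := @ler_sum R _ (index_enum _) xpredT _ _ (fun i _ => node i).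
set S := \sum_(i < n) node_rate _ _ _ _ _ _ _ _ _ _ _ _ _ _ _ _ _ => hS.
have thE : \sum_i ((s_th x i - s_th xs i) * s_th F i - nu i * (laplacian E B (s_th F) i
       + laplacian E B (fun j => s_th x j - s_th xs j) i)) = - \sum_i s_th F i ^+ 2.
  transitivity (\sum_i (s_th x i - s_th xs i) * s_th F i
      - \sum_i nu i * laplacian E B (s_th F) i
      - \sum_i nu i * laplacian E B (fun j => s_th x j - s_th xs j) i).
    by rewrite -!sumrB; apply: eq_bigr => i _; ring.
  rewrite (laplacian_sym _ _ nu (s_th F)) (laplacian_sym _ _ nu) -!sumrB -sumrN.
  by apply: eq_bigr => i _; rewrite -FthE; ring.
have PE : \sum_i rho i * (divergence E (s_P F) i
      + divergence E (fun j k => s_P x j k - s_P xs j k) i) =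
    \sum_i \sum_(j | E i j) s_P F i j ^+ 2
    + \sum_i \sum_(j | E i j) (s_P x i j - s_P xs i j) * s_P F i j.
  under eq_bigr do rewrite mulrDr.
  rewrite big_split /= !sum_divergence; congr (_ + _); apply: eq_bigr => i _;
  by apply: eq_bigr => j _; rewrite -FPE.
rewrite /lyapunov_rate -/F -/S.
move: hS; rewrite sumrB big_split /= thE PE => hS.
have cle : c <= 1 by rewrite /c; have := k0; have := k1; nra.
have : c * \sum_i (s_eta F i ^+ 2 + s_d F i ^+ 2 + s_th F i ^+ 2 + s_lam F i ^+ 2 + s_mu F i ^+ 2)
  <= \sum_i ((1 - kappa) / 2 * (s_d F i ^+ 2 + s_eta F i ^+ 2) + v i ^+ 2 / 2 + u i ^+ 2 / 2)
     + \sum_i s_th F i ^+ 2.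
  rewrite mulr_sumr -big_split /=; apply: ler_sum => i _.
  have -> : rhs_lam E Pin D (s_d x) (s_P x) (s_lam x) i = u i / 2 by [].
  have -> : rhs_mu E B Pin (s_d x) (s_th x) i = v i / 2 by [].
  have q (z : R) : c * z ^+ 2 <= 1 * z ^+ 2 by apply: ler_wpM2r; [exact: sqr_ge0|].
  have q2 (z : R) : c * z ^+ 2 <= (1 - kappa) / 2 * z ^+ 2.
    by apply: ler_wpM2r; [exact: sqr_ge0|rewrite /c; have := k0; have := k1; nra].
  have := q2 (s_eta F i); have := q2 (s_d F i); have := q (s_th F i); have := q (u i); have := q (v i).
  have := sqr_ge0 (u i); have := sqr_ge0 (v i); rewrite /F /=; lra.
have : c * \sum_i \sum_(j | E i j) s_P F i j ^+ 2 <= \sum_i \sum_(j | E i j) s_P F i j ^+ 2.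
  rewrite ler_piMl // sumr_ge0 // => i _; apply: sumr_ge0 => j _; exact: sqr_ge0.
move=> h1 h2; move: hS; rewrite sumrN /sqnorm -/F; lra.
Qed.

End lyapunov.

(** * Convergence of trajectories *)

Lemma derivative_along {R : realType} (V dV : R -> R) (s t : R) :
  (forall t : R, 0 < t -> is_derive t 1 V (dV t)) -> 0 < s -> s < t ->
  exists2 r, s < r < t & V t - V s = dV r * (t - s).
Proof.
move=> dVP s0 st.
have [r||r rst H] := @MVT R V dV s t st.
- by rewrite in_itv /= => /andP[sr _]; apply: dVP; exact: lt_trans sr.
- apply: derivable_within_continuous => r; rewrite in_itv /= => /andP[sr _].
  by have := dVP r (lt_le_trans s0 sr) => ?; exact: ex_derive.
- by exists r => //; move: rst; rewrite in_itv.
Qed.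

Lemma nonincreasing_along {R : realType} (V dV : R -> R) (s t : R) :
  (forall t : R, 0 < t -> is_derive t 1 V (dV t)) -> (forall t, 0 < t -> dV t <= 0) ->
  0 < s -> s <= t -> V t <= V s.
Proof.
move=> dVP dV0 s0; rewrite le_eqVlt => /predU1P[-> //|st].
have [r /andP[sr rt]] := derivative_along V dV s t dVP s0 st.
by have := dV0 r (lt_trans s0 sr); nra.
Qed.

Lemma recurrent_small_rate {R : realType} (V dV : R -> R) (s e : R) :
  (forall t : R, 0 < t -> is_derive t 1 V (dV t)) -> (forall t, 0 < t -> 0 <= V t) ->
  0 < s -> 0 < e -> exists2 t, s < t & - e < dV t.
Proof.
move=> dVP V0 s0 e0; pose h := (V s + 1) / e.
(* Decreasing at rate [e] for a time [h] would cost [V s + 1], making [V] negative. *)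
have h0 : 0 < h by rewrite divr_gt0 // ltr_wpDl // V0.
have sh : s < s + h by rewrite ltrDl.
have [r /andP[sr rt] H] := derivative_along V dV s (s + h) dVP s0 sh.
exists r => //; rewrite ltNge; apply/negP => re.
have := V0 (s + h) (lt_trans s0 sh).
have : e * h = V s + 1 by rewrite /h mulrC divfK // gt_eqF.
nra.
Qed.

(* An ultrafilter of times going to infinity along which [dV] tends to 0: it
   plays the role of a sequence along which all bounded quantities converge. *)
Lemma small_rate_ultrafilter {R : realType} (V dV : R -> R) :
  (forall t : R, 0 < t -> is_derive t 1 V (dV t)) -> (forall t, 0 < t -> 0 <= V t) ->
  exists U : set_system R, UltraFilter U /\
    forall s e, 0 < e -> U [set t | s < t /\ - e < dV t].
Proof.
move=> dVP V0.
pose G := [set se : R * R | 0 < se.1 /\ 0 < se.2].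
pose A (se : R * R) := [set t | se.1 < t /\ - se.2 < dV t].
have PF : ProperFilter (filter_from G A).
  apply: filter_from_proper; last first.
    move=> [s e] [/= s0 e0].
    by have [t st te] := recurrent_small_rate V dV s e dVP V0 s0 e0; exists t.
  apply: filter_from_filter; first by exists (1, 1); split; exact: ltr01.
  move=> [s e] [s' e'] [/= s0 e0] [/= s0' e0'].
  exists (Num.max s s', Num.min e e'); first by split => /=; rewrite ?lt_max ?lt_min ?s0 ?e0.
  move=> t [/=]; rewrite gt_max => /andP[st st'] h.
  have h1 : Num.min e e' <= e by rewrite ge_min lexx.
  have h2 : Num.min e e' <= e' by rewrite ge_min lexx orbT.
  by split; split => //=; lra.
have [U [UU FU]] := ultraFilterLemma PF.
exists U; split => // s e e0; apply: FU.
exists (Num.max 1 s, e) => /=; first by split => //=; rewrite lt_max ltr01.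
by move=> t [/=]; rewrite gt_max => /andP[_ st] h.
Qed.

(** The image of an ultrafilter is an ultrafilter, and an ultrafilter containing a compact segment
    converges. *)
Lemma ultrafilter_bounded_cvg {R : realType} {T : Type} (U : set_system T)
    (f : T -> R) (M : R) :
  UltraFilter U -> U [set t | `|f t| <= M] -> exists l : R, f t @[t --> U] --> l.
Proof.
move=> UU UM.
have PU : ProperFilter U by exact: ultra_proper.
have UI : UltraFilter (f @ U).
  split => [|G PG UG]; first exact: fmap_proper_filter.
   apply/seteqP; split => // A GA.
  have [//|UA] := in_ultra_setVsetC (f @^-1` A) UU.
  have /filter_ex[x []//] : G (A `&` ~` A) by apply: filterI => //; exact: UG.
have := @segment_compact R (- M) M; rewrite compact_ultra => /(_ _ UI) [|l [_ lP]].
  apply: (@filterS _ U _ _ _ _ UM) => t /=; by rewrite in_itv /= ler_norml.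
by exists l.
Qed.

(** The differential equations hold at positive times only, so Lyapunov estimates start at time 1;
    continuity up to 0 covers [[0, 1]]. *)
Lemma bounded_fwd_eventually {R : realType} (f : R -> R) (M : R) :
  {within `[0, +oo[%classic, continuous f} -> (forall t, 1 <= t -> `|f t| <= M) ->
  bounded_fwd f.
Proof.
move=> cf HM.
have c01 : {within `[0, 1], continuous f}.
  by apply: continuous_subspaceW cf => t /=; rewrite !in_itv /= andbT => /andP[].
have [a _ aP] := @EVT_max R f 0 1 ler01 c01; have [b _ bP] := @EVT_min R f 0 1 ler01 c01.
exists (M + `|f a| + `|f b|) => t t0.
have [t1|t1] := leP 1 t.
  by have := HM t t1; have := normr_ge0 (f a); have := normr_ge0 (f b); lra.
have tin : t \in `[0, 1] by rewrite in_itv /= t0 ltW.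
have M0 : 0 <= M by apply: le_trans (HM 1 _).
have := aP t tin; have := bP t tin; have := ler_norm (f a); have := ler_norm (- f b).
have := normr_ge0 (f a); have := normr_ge0 (f b).
by rewrite normrN => *; rewrite ler_norml; apply/andP; split; lra.
Qed.

(* [expR t * (x t - b)] has derivative [expR t * (p t - b) <= 0]. *)
Lemma relaxation_upper_bound {R : realType} (x p : R -> R) (b : R) :
  {within `[0, +oo[%classic, continuous x} ->
  (forall t : R, 0 < t -> is_derive t 1 x (p t - x t)) -> (forall t, 0 < t -> p t <= b) ->
  x 0 <= b -> forall t, 0 <= t -> x t <= b.
Proof.
move=> cx dx pb x0 t; rewrite le_eqVlt => /predU1P[<- //|t0].
pose g s := expR s * (x s - b).
have [r||r] := @MVT R g (fun s => expR s * (p s - b)) 0 t t0.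
- rewrite in_itv /= => /andP[r0 _]; have ? := dx r r0.
  by rewrite /g; apply: is_derive_eq; rewrite /GRing.scale /=; ring.
- have cx' : {within `[0, t], continuous x}.
    by apply: continuous_subspaceW cx => s /=; rewrite !in_itv /= andbT => /andP[].
  move=> s; apply: cvgM; first by apply: continuous_subspaceT; exact: continuous_expR.
  by apply: cvgB; [exact: cx'|exact: cvg_cst].
rewrite in_itv /= => /andP[r0 rt] gE.
have : g t <= 0.
  have e0 := expR_gt0 r; have pr := pb r r0.
  have : expR r * (p r - b) * (t - 0) <= 0.
    by rewrite -mulrA pmulr_rle0 // subr0 mulr_le0_ge0 // ?subr_le0 // ltW.
  by rewrite -gE /g expR0 mul1r; lra.
by rewrite /g pmulr_rle0 ?expR_gt0 // subr_le0.
Qed.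

Lemma relaxation_invariant {R : realType} (x p : R -> R) (a b : R) :
  {within `[0, +oo[%classic, continuous x} ->
  (forall t : R, 0 < t -> is_derive t 1 x (p t - x t)) -> (forall t, 0 < t -> a <= p t <= b) ->
  a <= x 0 <= b -> forall t, 0 <= t -> a <= x t <= b.
Proof.
move=> cx dx pab /andP[ax xb] t t0; apply/andP; split; last first.
  by apply: (@relaxation_upper_bound R x p) => // s /pab/andP[].
rewrite -lerN2; apply: (@relaxation_upper_bound R (fun s => - x s) (fun s => - p s)) => //.
- by move=> s; apply: cvgN; exact: cx.
- by move=> s s0; have ? := dx s s0; apply: is_derive_eq; ring.
- by move=> s /pab/andP[]; rewrite lerN2.
- by rewrite lerN2.
Qed.

(** * Limits along a trajectory *)

Section convergence.
Context {R : realType} {n : nat} (E : rel 'I_n) (B : 'I_n -> 'I_n -> R)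
  (D Pin lo hi : 'I_n -> R) (f0 f2 : 'I_n -> R -> R) (beta kappa : R).
Hypothesis Hconn : weakly_connected E.
Hypothesis HB : forall i j, E i j -> 0 < B i j.
Hypothesis HD : forall i, 0 < D i.
Hypothesis Hkappa : 0 < kappa < 1.
Hypothesis Hf0d : forall i x, derivable (f0 i) x 1.
Hypothesis Hf2cvx : forall i, convex_on_R (f2 i).
Hypothesis Hbeta : 1 < beta.
Hypothesis Hf0sc : forall i, strongly_convex beta (f0 i).
Hypothesis Hlohi : forall i, lo i <= hi i.

Local Notation state := (state R n).
Local Notation field := (vector_field E B D Pin lo hi f0 f2 kappa).
Local Notation V := (lyapunov E B D Pin f0 kappa).
Local Notation dV := (lyapunov_rate E B D Pin lo hi f0 f2 kappa).
Local Notation i1 := (injection1 E D Pin).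
Local Notation i2 := (injection2 E B Pin).
Local Notation is_eq := (is_equilibrium E B D Pin lo hi f0 f2 kappa).
Local Notation sqn := (sqnorm E).

Let beta0 : 0 <= beta. Proof. exact: le_trans ler01 (ltW Hbeta). Qed.

Definition state_derive (X : R -> state) (t : R) (y : state) : Prop :=
  [/\ forall i, is_derive t 1 (fun s => s_eta (X s) i) (s_eta y i),
      forall i, is_derive t 1 (fun s => s_d (X s) i) (s_d y i),
      forall i, is_derive t 1 (fun s => s_th (X s) i) (s_th y i),
      forall i j, E i j -> is_derive t 1 (fun s => s_P (X s) i j) (s_P y i j) &
      (forall i, is_derive t 1 (fun s => s_lam (X s) i) (s_lam y i)) /\
      (forall i, is_derive t 1 (fun s => s_mu (X s) i) (s_mu y i))].

Definition state_cvg (F : set_system R) (X : R -> state) (y : state) : Prop :=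
  [/\ forall i, s_eta (X s) i @[s --> F] --> s_eta y i,
      forall i, s_d (X s) i @[s --> F] --> s_d y i,
      forall i, s_th (X s) i @[s --> F] --> s_th y i,
      forall i j, E i j -> s_P (X s) i j @[s --> F] --> s_P y i j &
      (forall i, s_lam (X s) i @[s --> F] --> s_lam y i) /\
      (forall i, s_mu (X s) i @[s --> F] --> s_mu y i)].

Lemma is_derive_divergence (G : R -> 'I_n -> 'I_n -> R) (y : 'I_n -> 'I_n -> R) (t : R) i :
  (forall i j, E i j -> is_derive t 1 (fun s => G s i j) (y i j)) ->
  is_derive t 1 (fun s => divergence E (G s) i) (divergence E y i).
Proof.
move=> H; apply: is_deriveB.
  by apply: (is_derive_sumr _ _ (fun j s => G s i j)) => j; exact: H.
by apply: (is_derive_sumr _ _ (fun j s => G s j i)) => j; exact: H.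
Qed.

Lemma is_derive_lyapunov xs (X : R -> state) (t : R) :
  state_derive X t (field (X t)) ->
  is_derive t 1 (fun s => V xs (X s)) (dV xs (X t)).
Proof.
move=> [Heta Hd Hth HP [Hlam Hmu]].
apply: is_deriveD; last first.
  apply: (is_derive_sumr _ _ (fun i s => \sum_(j | E i j) (s_P (X s) i j - s_P xs i j) ^+ 2 / 2)) => i _.
  apply: (is_derive_sumr _ _ (fun j s => (s_P (X s) i j - s_P xs i j) ^+ 2 / 2)) => j Eij.
  have ? := HP i j Eij.
  by apply: is_derive_eq; rewrite /GRing.scale /=; field.
apply: (is_derive_sumr _ _ (fun i s => node_lyapunov kappa (D i) (s_eta (X s) i - s_eta xs i)
    (s_d (X s) i - s_d xs i) (s_mu (X s) i - s_mu xs i) (s_th (X s) i - s_th xs i)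
    (s_lam (X s) i) (i1 (X s) i) (i2 (X s) i) (bregman (f0 i) (s_d (X s) i) (s_d xs i)))) => i _.
have He := Heta i; have Hdi := Hd i; have Hti := Hth i; have Hli := Hlam i; have Hmi := Hmu i.
have Hu : is_derive t 1 (fun s => i1 (X s) i) (- s_d (field (X t)) i
    - D i * s_lam (field (X t)) i - divergence E (s_P (field (X t))) i).
  have Hdiv := is_derive_divergence _ _ t i HP.
  under eq_fun do rewrite /injection1 u1_divergence.
  by apply: is_derive_eq; rewrite /GRing.scale /=; ring.
have Hv : is_derive t 1 (fun s => i2 (X s) i) (- s_d (field (X t)) i
    - laplacian E B (s_th (field (X t))) i).
  have Hlap : is_derive t 1 (fun s => laplacian E B (s_th (X s)) i)
      (laplacian E B (s_th (field (X t))) i).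
    exact: (is_derive_divergence (fun s j k => B j k * (s_th (X s) j - s_th (X s) k))).
  under eq_fun do rewrite /injection2 u2_laplacian.
  by apply: is_derive_eq; rewrite /GRing.scale /=; ring.
have Hb : is_derive t 1 (fun s => bregman (f0 i) (s_d (X s) i) (s_d xs i))
    ((derive1 (f0 i) (s_d (X t) i) - derive1 (f0 i) (s_d xs i)) * s_d (field (X t)) i).
  have Hf : is_derive (s_d (X t) i) 1 (f0 i) (derive1 (f0 i) (s_d (X t) i)).
    by rewrite derive1E; apply: derivableP; exact: Hf0d.
  have Hc := @is_derive1_comp R (f0 i) (fun s => s_d (X s) i) t _ _ Hf Hdi.
  rewrite (_ : (fun s => bregman _ _ _) = (fun s => (f0 i \o (fun s => s_d (X s) i)) s
      - f0 i (s_d xs i) - derive1 (f0 i) (s_d xs i) * (s_d (X s) i - s_d xs i))) //.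
  by apply: is_derive_eq; rewrite /GRing.scale /=; ring.
exact (is_derive_node_lyapunov kappa (D i) t _ _ _ _ _ _ _ _ (s_eta xs i) (s_d xs i)
  (s_mu xs i) (s_th xs i) _ _ _ _ _ _ _ _ He Hdi Hmi Hti Hli Hu Hv Hb).
Qed.

Lemma cvg_divergence (F : set_system R) (FF : Filter F) (G : R -> 'I_n -> 'I_n -> R)
    (y : 'I_n -> 'I_n -> R) i :
  (forall i j, E i j -> G s i j @[s --> F] --> y i j) ->
  divergence E (G s) i @[s --> F] --> divergence E y i.
Proof. by move=> H; apply: cvgB; apply: cvg_sumr => j; exact: H. Qed.

Lemma cvg_laplacian (F : set_system R) (FF : Filter F) (x : R -> 'I_n -> R)
    (y : 'I_n -> R) i :
  (forall i, x s i @[s --> F] --> y i) ->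
  laplacian E B (x s) i @[s --> F] --> laplacian E B y i.
Proof.
move=> H; apply: cvg_divergence => j k _.
by apply: cvgM; [exact: cvg_cst|exact: cvgB].
Qed.

Lemma cvg_injection1 (F : set_system R) (FF : Filter F) (X : R -> state) y i :
  state_cvg F X y -> i1 (X s) i @[s --> F] --> i1 y i.
Proof.
move=> [_ Hd _ HP [Hlam _]]; rewrite /injection1 u1_divergence.
under eq_fun do rewrite u1_divergence.
apply: cvgB; last exact: cvg_divergence.
by apply: cvgB; [apply: cvgB => //; exact: cvg_cst|apply: cvgM => //; exact: cvg_cst].
Qed.

Lemma cvg_injection2 (F : set_system R) (FF : Filter F) (X : R -> state) y i :
  state_cvg F X y -> i2 (X s) i @[s --> F] --> i2 y i.
Proof.
move=> [_ Hd Hth _ _]; rewrite /injection2 u2_laplacian.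
under eq_fun do rewrite u2_laplacian.
by apply: cvgB; [apply: cvgB => //; exact: cvg_cst|exact: cvg_laplacian].
Qed.

Lemma derive1_f0_continuous i : continuous (derive1 (f0 i)).
Proof.
apply: tangent_derive1_continuous => // x y.
have := strongly_convex_tangent beta (f0 i) x y beta0 (Hf0sc i) (Hf0d i x).
have : 0 <= beta / 2 * (y - x) ^+ 2 by rewrite mulr_ge0 ?sqr_ge0 // divr_ge0.
lra.
Qed.

Lemma cvg_vector_field (F : set_system R) (FF : Filter F) (X : R -> state) y :
  state_cvg F X y -> state_cvg F (fun s => field (X s)) (field y).
Proof.
move=> XY; have [Heta Hd Hth HP [Hlam Hmu]] := XY.
have H1 := cvg_injection1 F FF X y ^~ XY; have H2 := cvg_injection2 F FF X y ^~ XY.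
split=> [i|i|i|i j Eij|] /=.
- rewrite /rhs_eta; apply: cvgB => //.
  apply: (cvg_comp (fun s => s_d (X s) i - kappa * s_eta (X s) i) (prox (fun x => (f2 i x)%:E)));
    last exact: prox_continuous.
  by apply: cvgB => //; apply: cvgM => //; exact: cvg_cst.
- rewrite /rhs_d; apply: cvgB => //.
  apply: (cvg_comp (fun s => s_d (X s) i - derive1 (f0 i) (s_d (X s) i) + kappa * s_eta (X s) i
    + s_lam (X s) i + i1 (X s) i + s_mu (X s) i + i2 (X s) i) (prox (indicator_itv (lo i) (hi i))));
    last exact: prox_itv_continuous.
  apply: cvgD; last exact: H2.
  apply: cvgD; last exact: Hmu.
  apply: cvgD; last exact: H1.
  apply: cvgD; last exact: Hlam.
  apply: cvgD; last by apply: cvgM => //; exact: cvg_cst.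
  apply: cvgB; first exact: Hd.
  apply: (cvg_comp (fun s => s_d (X s) i) (derive1 (f0 i)));
    [exact: Hd|exact: derive1_f0_continuous].
- rewrite rhs_th_laplacian; under eq_fun do rewrite rhs_th_laplacian.
  by apply: cvg_laplacian => // j; apply: cvgD => //; exact: H2.
- rewrite /rhs_P.
  by apply: cvgB; [apply: cvgB => //; apply: cvgD => //; exact: H1|exact: H1].
- by split=> i; apply: cvgM; [exact: H1|exact: cvg_cst|exact: H2|exact: cvg_cst].
Qed.

Lemma cvg_lyapunov (F : set_system R) (FF : Filter F) (X : R -> state) y :
  is_eq y -> state_cvg F X y -> V y (X s) @[s --> F] --> (0 : R).
Proof.
move=> yeq XY; have [Heta Hd Hth HP [Hlam Hmu]] := XY.
have H1 := cvg_injection1 F FF X y ^~ XY; have H2 := cvg_injection2 F FF X y ^~ XY.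
have [_ _ lam0 HL Hdiv] := is_equilibriumP E B D Pin lo hi f0 f2 kappa Hconn HB HD Hf2cvx Hlohi y yeq.
have i10 i : i1 y i = 0 by rewrite /injection1 u1_divergence Hdiv lam0; ring.
have i20 i : i2 y i = 0 by rewrite /injection2 u2_laplacian HL; ring.
have sub0 (f : R -> R) (l : R) : f s @[s --> F] --> l -> (f s - l) @[s --> F] --> (0 : R).
  by move=> fl; rewrite -(subrr l); apply: cvgB => //; exact: cvg_cst.
have sq (f : R -> R) (l : R) : f s @[s --> F] --> l -> f s ^+ 2 @[s --> F] --> l ^+ 2.
  by move=> fl; exact: cvgM.
have cM (k l : R) (f : R -> R) : f s @[s --> F] --> l -> k * f s @[s --> F] --> k * l.
  by move=> fl; apply: cvgM => //; exact: cvg_cst.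
have h (l : R) (f : R -> R) : f s @[s --> F] --> l -> f s / 2 @[s --> F] --> l / 2.
  by move=> fl; apply: cvgM => //; exact: cvg_cst.
(* The limit is rewritten in the shape of the Lyapunov function, so that convergence is checked term
   by term. *)
have -> : (0 : R) = \sum_i node_lyapunov kappa (D i) 0 0 0 0 0 0 0 0
    + \sum_i \sum_(j | E i j) (0 : R) ^+ 2 / 2.
  rewrite big1 => [|i _]; last by rewrite /node_lyapunov; ring.
  by rewrite add0r big1 // => i _; rewrite big1 // => j _; rewrite expr0n mul0r.
apply: cvgD; apply: cvg_sumr => i _.
  have L0 : s_lam (X s) i @[s --> F] --> (0 : R) by rewrite -(lam0 i).
  have I1 : i1 (X s) i @[s --> F] --> (0 : R) by rewrite -(i10 i).
  have I2 : i2 (X s) i @[s --> F] --> (0 : R) by rewrite -(i20 i).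
  have Hb : bregman (f0 i) (s_d (X s) i) (s_d y i) @[s --> F] --> (0 : R).
    have -> : (0 : R) = f0 i (s_d y i) - f0 i (s_d y i) - derive1 (f0 i) (s_d y i) * 0 by ring.
    apply: cvgB; last by apply: cM; exact: sub0.
    apply: cvgB; last exact: cvg_cst.
    apply: (cvg_comp (fun s => s_d (X s) i) (f0 i)); first exact: Hd.
    suff : {for s_d y i, continuous (f0 i)} by [].
    by apply/differentiable_continuous/derivable1_diffP; exact: Hf0d.
  rewrite /node_lyapunov.
  have e0 := sub0 _ _ (Heta i); have d0 := sub0 _ _ (Hd i).
  have m0 := sub0 _ _ (Hmu i); have t0 := sub0 _ _ (Hth i).
  apply: cvgD; last by apply: h; apply: cM; exact: sq.
  apply: cvgD; last by apply: h; exact: sq.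
  apply: cvgD; last by apply: h; apply: sq; exact: cvgD.
  apply: cvgD; last by apply: h; exact: sq.
  apply: cvgD; last by apply: h; exact: sq.
  apply: cvgD; last by apply: h; apply: sq; exact: cvgD.
  apply: cvgB; last by apply: cM; exact: cvgM.
  apply: cvgD; last by apply: h; apply: cM; exact: sq.
  by apply: cvgD => //; apply: h; exact: sq.
by apply: cvg_sumr => j Eij; apply: h; apply: sq; apply: sub0; exact: HP.
Qed.

Let c : R := kappa * (1 - kappa) / 4.

Let c_gt0 : 0 < c. Proof. exact: lyapunov_constant_gt0. Qed.

Let V_ge (xs x : state) : is_eq xs -> c * sqn (state_sub x xs) <= V xs x.
Proof. by move=> h; apply: (@lyapunov_ge R n E B D Pin lo hi f0 f2 beta). Qed.

Let dV_le (xs x : state) : is_eq xs -> dV xs x <= - (c * sqn (field x)).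
Proof. by move=> h; apply: (@lyapunov_rate_le R n E B D Pin lo hi f0 f2 beta). Qed.

Let V_ge0 (xs x : state) : is_eq xs -> 0 <= V xs x.
Proof. by move=> /(V_ge xs x); apply: le_trans; rewrite mulr_ge0 ?sqnorm_ge0 // ltW. Qed.

Let norm_le_of_sqr (a e : R) : 0 <= e -> a ^+ 2 <= e ^+ 2 -> `|a| <= e.
Proof. by move=> e0; rewrite -(real_normK (num_real a)) ler_pXn2r // nnegrE. Qed.

Lemma sqnorm_components (x : state) (e : R) : 0 <= e -> sqn x <= e ^+ 2 ->
  [/\ forall i, `|s_eta x i| <= e, forall i, `|s_d x i| <= e,
      forall i, `|s_th x i| <= e, forall i j, E i j -> `|s_P x i j| <= e &
      (forall i, `|s_lam x i| <= e) /\ (forall i, `|s_mu x i| <= e)].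
Proof.
move=> e0 xe.
have node i := le_trans (sqnorm_ge_node E x i) xe.
have line i j Eij := le_trans (sqnorm_ge_line E x i j Eij) xe.
have h i := (sqr_ge0 (s_eta x i), sqr_ge0 (s_d x i), sqr_ge0 (s_th x i),
  sqr_ge0 (s_lam x i), sqr_ge0 (s_mu x i)).
split=> [i|i|i|i j Eij|]; last split=> i.
all: apply: norm_le_of_sqr => //.
4: exact: line.
all: by have := node i; have [[[[]]]] := h i; lra.
Qed.

Context (X : R -> state).
Hypothesis HX : forall t, 0 < t -> state_derive X t (field (X t)).

Let V_derive xs (t : R) : 0 < t -> is_derive t 1 (fun s => V xs (X s)) (dV xs (X t)).
Proof. by move=> t0; apply: is_derive_lyapunov; exact: HX. Qed.

Lemma lyapunov_nonincreasing xs s t : is_eq xs -> 0 < s -> s <= t -> V xs (X t) <= V xs (X s).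
Proof.
move=> xseq s0 st.
apply: (@nonincreasing_along R (fun s => V xs (X s)) (fun s => dV xs (X s)) _ _ (V_derive xs)) => // r r0.
by apply: le_trans (dV_le xs (X r) xseq) _; rewrite oppr_le0 mulr_ge0 ?sqnorm_ge0 // ltW.
Qed.

(** Lyapunov stability: sublevel sets of [V xs] are forward invariant and, by coercivity, lie in
    balls around [xs]. *)
Lemma trajectory_close xs s t e : is_eq xs -> 0 < s -> s <= t ->
  V xs (X s) <= c * e ^+ 2 -> sqn (state_sub (X t) xs) <= e ^+ 2.
Proof.
move=> xseq s0 st Ve; rewrite -(ler_pM2l c_gt0).
apply: le_trans (V_ge _ _ xseq) _; apply: le_trans Ve.
exact: lyapunov_nonincreasing.
Qed.

Lemma trajectory_bounded xs : is_eq xs -> exists2 K, 0 <= K &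
  forall t, 1 <= t -> sqn (state_sub (X t) xs) <= K ^+ 2.
Proof.
move=> xseq; have V0 := V_ge0 xs (X 1) xseq.
(* Since [q <= (q + 1) ^+ 2] for [q >= 0], this radius spares a square root. *)
pose K := V xs (X 1) / c + 1.
have q0 : 0 <= V xs (X 1) / c by rewrite divr_ge0 // ltW.
exists K => [|t t1]; first by rewrite /K; lra.
apply: (trajectory_close xs 1) => //.
have : V xs (X 1) = c * (V xs (X 1) / c) by rewrite mulrC divfK // gt_eqF.
by rewrite /K; have := c_gt0; nra.
Qed.

Let cvg_small_eq0 (U : set_system R) (PU : ProperFilter U) (f : R -> R) (l : R) :
  f s @[s --> U] --> l -> (forall e, 0 < e -> U [set t | `|f t| <= e]) -> l = 0.
Proof.
move=> fl fs; apply: (@cvg_unique _ (@Rhausdorff R) (f @ U)) => //.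
by apply/cvgrPdist_le => e e0; apply: filterS (fs e e0) => t /=; rewrite sub0r normrN.
Qed.

Lemma trajectory_cvg xs : is_eq xs -> exists2 y, is_eq y & state_cvg (pinfty_nbhs R) X y.
Proof.
move=> xseq.
have [U [UU Usmall]] := small_rate_ultrafilter (fun s => V xs (X s)) (fun s => dV xs (X s))
  (V_derive xs) (fun t _ => V_ge0 xs (X t) xseq).
have PU : ProperFilter U by exact: ultra_proper.
have FU : Filter U by exact: filter_filter.
have Ugt s : U [set t | s < t] by apply: filterS (Usmall s 1 ltr01) => t [].
have [K K0 KP] := trajectory_bounded xs xseq.
have ucvg (f : R -> R) l : (forall t, 1 <= t -> `|f t - l| <= K) ->
    exists l' : R, f t @[t --> U] --> l'.
  move=> H; apply: (ultrafilter_bounded_cvg U f (K + `|l|)) => //.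
  apply: filterS (Ugt 1) => t /= t1.
  by have := H t (ltW t1); have := ler_normD (f t - l) l; rewrite subrK; lra.
have comp t (t1 : 1 <= t) := sqnorm_components (state_sub (X t) xs) K K0 (KP t t1).
have ex_e i : exists l : R, s_eta (X t) i @[t --> U] --> l.
  by apply: (ucvg _ (s_eta xs i)) => t /comp[+ _ _ _ _]; exact.
have [le leP] := choice ex_e.
have ex_d i : exists l : R, s_d (X t) i @[t --> U] --> l.
  by apply: (ucvg _ (s_d xs i)) => t /comp[_ + _ _ _]; exact.
have [ld ldP] := choice ex_d.
have ex_t i : exists l : R, s_th (X t) i @[t --> U] --> l.
  by apply: (ucvg _ (s_th xs i)) => t /comp[_ _ + _ _]; exact.
have [lt ltP] := choice ex_t.
have ex_p (ij : 'I_n * 'I_n) : exists l : R,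
    E ij.1 ij.2 -> s_P (X t) ij.1 ij.2 @[t --> U] --> l.
  (* Off the lines nothing is claimed about the flow, and 0 is a placeholder. *)
  case: ij => i j /=; have [Eij|_] := boolP (E i j); last by exists 0.
  have [|l lP] := ucvg (fun t => s_P (X t) i j) (s_P xs i j); last by exists l.
  by move=> t /comp[_ _ _ + _]; exact.
have [lp lpP] := choice ex_p.
have ex_l i : exists l : R, s_lam (X t) i @[t --> U] --> l.
  by apply: (ucvg _ (s_lam xs i)) => t /comp[_ _ _ _ [+ _]]; exact.
have [ll llP] := choice ex_l.
have ex_m i : exists l : R, s_mu (X t) i @[t --> U] --> l.
  by apply: (ucvg _ (s_mu xs i)) => t /comp[_ _ _ _ [_ +]]; exact.
have [lm lmP] := choice ex_m.
pose y := State le ld lt (fun i j => lp (i, j)) ll lm.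
have XU : state_cvg U X y by split => // i j Eij; exact: (lpP (i, j)).
have [Fe Fd Ft FP [Fl Fm]] := cvg_vector_field U FU X y XU.
have Fsmall e : 0 < e -> U [set t | sqn (field (X t)) <= e ^+ 2].
  move=> e0; have ce : 0 < c * e ^+ 2 by rewrite mulr_gt0 // exprn_gt0.
  apply: filterS (Usmall 0 _ ce) => t [_ /= h]; rewrite -(ler_pM2l c_gt0).
  by have := dV_le xs (X t) xseq; lra.
have yeq : is_eq y.
  split=> [i|]; last split=> [i|]; last split=> [i|]; last split=> [i j Eij|]; last split=> i.
  - apply: (cvg_small_eq0 U PU _ _ (Fe i)) => e e0; apply: filterS (Fsmall e e0) => t /= h.
    by have [+ _ _ _ _] := sqnorm_components _ _ (ltW e0) h; exact.
  - apply: (cvg_small_eq0 U PU _ _ (Fd i)) => e e0; apply: filterS (Fsmall e e0) => t /= h.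
    by have [_ + _ _ _] := sqnorm_components _ _ (ltW e0) h; exact.
  - apply: (cvg_small_eq0 U PU _ _ (Ft i)) => e e0; apply: filterS (Fsmall e e0) => t /= h.
    by have [_ _ + _ _] := sqnorm_components _ _ (ltW e0) h; exact.
  - apply: (cvg_small_eq0 U PU _ _ (FP i j Eij)) => e e0; apply: filterS (Fsmall e e0) => t /= h.
    by have [_ _ _ + _] := sqnorm_components _ _ (ltW e0) h; exact.
  - apply: (cvg_small_eq0 U PU _ _ (Fl i)) => e e0; apply: filterS (Fsmall e e0) => t /= h.
    by have [_ _ _ _ [+ _]] := sqnorm_components _ _ (ltW e0) h; exact.
  - apply: (cvg_small_eq0 U PU _ _ (Fm i)) => e e0; apply: filterS (Fsmall e e0) => t /= h.
    by have [_ _ _ _ [_ +]] := sqnorm_components _ _ (ltW e0) h; exact.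
exists y => //.
have Vy := cvg_lyapunov U FU X y yeq XU.
(* One time [s] of the ultrafilter with [V y (X s)] small suffices: monotonicity extends the bound
   to all later times. *)
have close e : 0 < e -> \forall t \near +oo, sqn (state_sub (X t) y) <= e ^+ 2.
  move=> e0; have ce : 0 < c * e ^+ 2 by rewrite mulr_gt0 // exprn_gt0.
  have /cvgrPdist_le/(_ _ ce) Vs := Vy.
  have [s [/= s0 Vse]] := @filter_ex _ U PU _ (@filterI _ U FU _ _ (Ugt 0) Vs).
  have Vs1 : V y (X s) <= c * e ^+ 2.
    by move: Vse; rewrite sub0r normrN; apply: le_trans; exact: ler_norm.
  near=> t.
  have st : s <= t by near: t; apply: nbhs_pinfty_ge; exact: num_real.
  exact: (trajectory_close y s).
split=> [i|i|i|i j Eij|]; last split=> i.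
all: apply/cvgrPdist_le => e e0; near=> t; rewrite distrC.
all: have h : sqn (state_sub (X t) y) <= e ^+ 2 by near: t; exact: close.
all: have [he hd ht hP [hl hm]] := sqnorm_components _ _ (ltW e0) h.
- exact: he.
- exact: hd.
- exact: ht.
- exact: hP.
- exact: hl.
- exact: hm.
Unshelve. all: by end_near. Qed.

End convergence.

Theorem theorem2 (R : realType) (n : nat) (E : rel 'I_n)
  (B : 'I_n -> 'I_n -> R) (D Pin lo hi : 'I_n -> R)
  (Plo Phi : 'I_n -> 'I_n -> R)
  (f0 f2 : 'I_n -> R -> R) (beta kappa : R)
  (* network *)
  (Hconn : weakly_connected E)
  (HB : forall i j, E i j -> 0 < B i j)
  (HD : forall i, 0 < D i)
  (Hkappa : 0 < kappa < 1)
  (* cost functions *)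
  (Hf0d : forall i x, derivable (f0 i) x 1)
  (Hf2cvx : forall i, convex_on_R (f2 i))
  (Hf2lsc : forall i, lower_semicontinuous (fun x => (f2 i x)%:E))
  (* Assumption 1 *)
  (Hbeta : 1 < beta)
  (Hf0sc : forall i, strongly_convex beta (f0 i))
  (* Assumption 2 (Slater) *)
  (Hlim : forall i j, E i j -> Plo i j <= Phi i j)
  (Hslater : exists (dt tht : 'I_n -> R),
      (forall i, in_relint_itv (lo i) (hi i) (dt i)) /\
      (forall i, u2 E B Pin dt tht i = 0) /\
      (forall i j, E i j -> Plo i j < B i j * (tht i - tht j) < Phi i j))
  (* a trajectory of the DPPD dynamics *)
  (eta d th : 'I_n -> R -> R) (P : 'I_n -> 'I_n -> R -> R)
  (w lam mu : 'I_n -> R -> R)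
  (Htraj : dppd_trajectory E B Pin D lo hi f0 f2 kappa eta d th P w lam mu) :
  (* 1) invariance of Omega *)
  ((forall i, lo i <= d i 0 <= hi i) ->
     forall i t, 0 <= t -> lo i <= d i t <= hi i) /\
  (* 2) boundedness *)
  ((forall i, bounded_fwd (eta i)) /\ (forall i, bounded_fwd (d i)) /\
   (forall i, bounded_fwd (th i)) /\ (forall i j, E i j -> bounded_fwd (P i j)) /\
   (forall i, bounded_fwd (w i)) /\ (forall i, bounded_fwd (mu i))) /\
  (* 3) convergence to an equilibrium whose (d, th, P, w) part is ROLC-optimal *)
  (exists (etas ds ths : 'I_n -> R) (Ps : 'I_n -> 'I_n -> R) (ws mus : 'I_n -> R),
     dppd_equilibrium E B Pin D lo hi f0 f2 kappa etas ds ths Ps ws mus /\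
     rolc_optimal E B Pin D lo hi f0 f2 ds ths ws Ps /\
     (forall i, eta i t @[t --> +oo] --> etas i) /\
     (forall i, d i t @[t --> +oo] --> ds i) /\
     (forall i, th i t @[t --> +oo] --> ths i) /\
     (forall i j, E i j -> P i j t @[t --> +oo] --> Ps i j) /\
     (forall i, w i t @[t --> +oo] --> ws i) /\
     (forall i, mu i t @[t --> +oo] --> mus i)).
Proof.
have [dt [tht [dtin [dtbal _]]]] := Hslater.
(* The Slater point yields nonempty intervals and a balanced load, from which an equilibrium is
   built. *)
have dtbox i : lo i <= dt i <= hi i.
  by case: (dtin i) => [/andP[/ltW -> /ltW ->]|[-> ->]] //; rewrite lexx.
have Hlohi i : lo i <= hi i by have /andP[] := dtbox i; exact: le_trans.
have [wlam [ceta [cd [cth [cP [clam [cmu dyn]]]]]]] := Htraj.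
pose X t := State (fun i => eta i t) (fun i => d i t) (fun i => th i t)
  (fun i j => P i j t) (fun i => lam i t) (fun i => mu i t).
pose field := vector_field E B D Pin lo hi f0 f2 kappa.
have HX t : 0 < t -> state_derive E X t (field (X t)).
  by move=> /dyn[He [Hd [Ht [HP [Hl Hm]]]]]; split.
have [es [ds [ts [Ps [ls [ms xseq]]]]]] :=
  equilibrium_exists E B D Pin lo hi f0 f2 beta kappa Hconn HB HD Hkappa Hf0d Hf2cvx Hbeta
    Hf0sc Hlohi dt tht dtbox dtbal.
pose xs := State es ds ts Ps ls ms.
have {}xseq : is_equilibrium E B D Pin lo hi f0 f2 kappa xs by [].
split; [|split].
(* The load relaxes towards a moving target that, being a projection, always lies in the
   interval. *)
- move=> d0 i; apply: (relaxation_invariant (d i) (fun t => prox (indicator_itv (lo i) (hi i))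
    (d i t - derive1 (f0 i) (d i t) + kappa * eta i t + lam i t
     + injection1 E D Pin (X t) i + mu i t + injection2 E B Pin (X t) i))) => //.
    by move=> t /dyn[_ [+ _]]; exact.
  by move=> t _; have [] := prox_itvP (lo i) (hi i) (d i t - derive1 (f0 i) (d i t)
    + kappa * eta i t + lam i t + injection1 E D Pin (X t) i + mu i t
    + injection2 E B Pin (X t) i) (Hlohi i).
- have [K K0 KP] := trajectory_bounded E B D Pin lo hi f0 f2 beta kappa Hconn HB HD Hkappa
    Hf0d Hf2cvx Hbeta Hf0sc Hlohi X HX xs xseq.
  have comp t (t1 : 1 <= t) := sqnorm_components E (state_sub (X t) xs) K K0 (KP t t1).
  have bdd (f : R -> R) (l : R) : {within `[0, +oo[%classic, continuous f} ->
      (forall t, 1 <= t -> `|f t - l| <= K) -> bounded_fwd f.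
    move=> cf H; apply: (@bounded_fwd_eventually R f (K + `|l|)) => // t t1.
    by have := H t t1; have := ler_normD (f t - l) l; rewrite subrK; lra.
  split; first by move=> i; apply: (bdd _ (es i)) => // t /comp[+ _ _ _ _]; exact.
  split; first by move=> i; apply: (bdd _ (ds i)) => // t /comp[_ + _ _ _]; exact.
  split; first by move=> i; apply: (bdd _ (ts i)) => // t /comp[_ _ + _ _]; exact.
  split; first by move=> i j Eij; apply: (bdd _ (Ps i j)); [exact: cP|move=> t /comp[_ _ _ + _]; exact].
  split; last by move=> i; apply: (bdd _ (ms i)) => // t /comp[_ _ _ _ [_ +]]; exact.
  move=> i; have -> : w i = lam i by apply/funext => t; exact: wlam.
  by apply: (bdd _ (ls i)) => // t /comp[_ _ _ _ [+ _]]; exact.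
- have [y yeq [ye yd yt yP [yl ym]]] := trajectory_cvg E B D Pin lo hi f0 f2 beta kappa Hconn
    HB HD Hkappa Hf0d Hf2cvx Hbeta Hf0sc Hlohi X HX xs xseq.
  exists (s_eta y), (s_d y), (s_th y), (s_P y), (s_lam y), (s_mu y); split => //.
  split.
    exact: (equilibrium_optimal E B D Pin lo hi f0 f2 beta kappa Hconn HB HD Hf0d
      Hf2cvx Hbeta Hf0sc Hlohi _ _ _ _ _ _ yeq).
  do 4 split => //.
  split => // i.
  have -> : w i = lam i by apply/funext => t; exact: wlam.
  exact: yl.
Qed.
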